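(* Let $K$ be a field of characteristic $p>0$ and $n\ge1$. For each $s=0,1,\dots,n-1$ write $\mathcal D(P_n)=\mathcal D(P_1)\otimes\mathcal D(P_1)^{\otimes s}\otimes\mathcal D(P_1)^{\otimes(n-s-1)}$. For each $k\in\mathbb N$ consider the cyclic finitely presented $\mathcal D(P_n)$-module $$M(k,s):=M(k)\otimes\mathcal D(P_1)^{\otimes s}\otimes\Lambda_{-1}^{\otimes(n-s-1)},$$ where $M(k):=\mathcal D(P_1)\otimes_{T_k}\bigl(T_k/T_k\Lambda_{[p^k],+}\bigr)$, a $\mathcal D(P_1)$-module. Then $\mathrm{Dim}\,M(k,s)=n+1+s$ and $e(M(k,s))=\frac1{p^k}$. So the multiplicity of a non-holonomic finitely presented $\mathcal D(P_n)$-module can be arbitrarily small (for each possible dimension $n+1,\dots,2n$).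
   Context: $\otimes=\otimes_K$ unless indicated. $P_n=K[x_1,\dots,x_n]$; $\mathcal D(P_n)$ is the ring of $K$-linear differential operators on $P_n$. For $k\ge0$ let $\partial_i^{[k]}=\frac{\partial_i^k}{k!}$ be the operator $x^\alpha\mapsto\binom{\alpha_i}{k}x^{\alpha-ke_i}$ (zero if $k>\alpha_i$), $\partial^{[\beta]}=\prod_i\partial_i^{[\beta_i]}$. Then $\mathcal D(P_n)=\bigoplus_{\alpha,\beta}Kx^\alpha\partial^{[\beta]}=\mathcal D(P_1)^{\otimes n}$. Canonical filtration: $F_i=\bigoplus_{|\alpha|+|\beta|\le i}Kx^\alpha\partial^{[\beta]}$. Modules are left modules. For $n=1$, $P_1=K[x]$: $\Lambda_{-1}:=\bigoplus_{j\ge0}K\partial^{[j]}\subset\mathcal D(P_1)$, regarded as the $\mathcal D(P_1)$-module $\mathcal D(P_1)/\mathcal D(P_1)x$; $\Lambda_{[p^k],+}:=\bigoplus_{1\le j<p^k}K\partial^{[j]}$; $T_k:=\bigoplus_{0\le j<p^k}\partial^{[j]}K[x]$, a subalgebra of $\mathcal D(P_1)$; $T_k\Lambda_{[p^k],+}$ is the left ideal of $T_k$ generated by $\Lambda_{[p^k],+}$. For $f:\mathbb N\to\mathbb N$, $\gamma(f):=\inf\{r\ge0: f(i)\le i^r\text{ for }i\gg0\}$. For $M=\mathcal D(P_n)M_0$ with $\dim_KM_0<\infty$, $D=\mathrm{Dim}(M):=\gamma(i\mapsto\dim_KF_iM_0)$ and, for $M$ finitely presented, the multiplicity $e(M)$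 is defined by $\dim_K(F_iM_0)=\frac{e(M)}{D!}i^D+o(i^D)$; both are independent of $M_0$. A nonzero finitely generated module $M$ is holonomic if $\dim_K(F_iM_0)\le q(i)$ for $i\gg0$ for some polynomial $q\in\mathbb Q[t]$ of degree $n$. *)

(* Defs.v *)
From HB Require Import structures.
From mathcomp Require Import all_boot all_order all_algebra.
From mathcomp Require Import mpoly zify.
From mathcomp Require Import boolp classical_sets functions reals ereal topology.
From mathcomp Require Import normedtype landau exp.

Set Implicit Arguments.
Unset Strict Implicit.
Unset Printing Implicit Defensive.

Import Order.TTheory GRing.Theory Num.Theory.
Import numFieldNormedType.Exports.

Local Open Scope classical_set_scope.
Local Open Scope ring_scope.

(* K-linear differential operators on a commutative K-algebra A, in the     *)
(* sense of Grothendieck: u has order <= 0 if it commutes with the          *)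
(* multiplications by elements of A, and order <= m + 1 if all its          *)
(* commutators with these multiplications have order <= m.                  *)
Fixpoint diffop_order (A : comNzRingType) (m : nat) (u : A -> A) : Prop :=
  if m is m'.+1 then
    forall r : A, diffop_order m' (fun a => r * u a - u (r * a))
  else forall r a : A, r * u a - u (r * a) = 0.

Section DiffOp.
Context {K : comNzRingType} {A : comAlgType K}.
Implicit Types u v : A -> A.

Lemma diffop_order_ext m u v : u =1 v -> diffop_order m u -> diffop_order m v.
Proof. by move=> /funext ->. Qed.

Lemma diffop_order0 m : diffop_order m (fun=> 0 : A).
Proof.
elim: m => [|m IH] /= r; first by move=> a; rewrite mulr0 subrr.
by apply: diffop_order_ext IH => a; rewrite mulr0 subrr.
Qed.

Lemma diffop_orderS m u : diffop_order m u -> diffop_order m.+1 u.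
Proof.
elim: m u => [|m IH] u /= H r; last exact: IH (H r).
by move=> s a; rewrite !H mulr0 subrr.
Qed.

Lemma diffop_orderW m m' u :
  (m <= m')%N -> diffop_order m u -> diffop_order m' u.
Proof.
move=> /subnK <-; elim: (m' - m)%N => [//|j IH] H.
by rewrite addSn; apply: diffop_orderS; exact: IH.
Qed.

Lemma diffop_orderD m u v : diffop_order m u -> diffop_order m v ->
  diffop_order m (fun a => u a + v a).
Proof.
elim: m u v => [|m IH] u v /= Hu Hv r.
  by move=> a; rewrite mulrDr opprD addrACA Hu Hv addr0.
apply: diffop_order_ext (IH _ _ (Hu r) (Hv r)) => a.
by rewrite mulrDr opprD addrACA.
Qed.

Lemma diffop_orderZ m (c : K) u :
  diffop_order m u -> diffop_order m (fun a => c *: u a).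
Proof.
elim: m u => [|m IH] u /= Hu r.
  by move=> a; rewrite -scalerAr -scalerBr Hu scaler0.
by apply: diffop_order_ext (IH _ (Hu r)) => a; rewrite -scalerAr -scalerBr.
Qed.

Lemma add_fun0 (f : A -> A) : (forall a b, f (a + b) = f a + f b) -> f 0 = 0.
Proof. by move=> fD; apply: (addrI (f 0)); rewrite -fD !addr0. Qed.

Lemma diffop_orderM m m' u v :
  (forall a b, u (a + b) = u a + u b) ->
  diffop_order m u -> diffop_order m' v ->
  diffop_order (m + m') (fun a => u (v a)).
Proof.
have eqcomm r (f g : A -> A) (fD : forall a b, f (a + b) = f a + f b) a :
    (r * f (g a) - f (r * g a)) + f (r * g a - g (r * a)) =
    r * f (g a) - f (g (r * a)).
  have fN b : f (- b) = - f b.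
    by apply/eqP; rewrite -addr_eq0 -fD addNr add_fun0.
  by rewrite fD fN addrA subrK.
have commD r (f : A -> A) : (forall a b, f (a + b) = f a + f b) ->
    forall a b, r * f (a + b) - f (r * (a + b)) =
                r * f a - f (r * a) + (r * f b - f (r * b)).
  by move=> fD a b; rewrite fD !mulrDr fD opprD addrACA.
move: {2}(m + m')%N (leqnn (m + m')) => N.
elim: N m m' u v => [|N IH] m m' u v leN uD Hu Hv.
  case: m m' leN Hu Hv => [|//] [|//] _ /= Hu Hv r a.
  by rewrite -(eqcomm r u v uD) Hu Hv add0r add_fun0.
have u0 := add_fun0 uD.
case: m m' leN Hu Hv => [|m] [|m'] leN Hu Hv.
- by move=> r a; rewrite -(eqcomm r u v uD) Hu Hv u0 addr0.
- rewrite add0n => r /=.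
  apply: (@diffop_order_ext _ (fun a => u (r * v a - v (r * a)))) => [a|].
    by rewrite -(eqcomm r u v uD) Hu add0r.
  by apply: (IH 0%N m').
- rewrite addn0 => r /=.
  apply: (@diffop_order_ext _ (fun a => r * u (v a) - u (r * v a))) => [a|].
    by rewrite -(eqcomm r u v uD) Hv u0 addr0.
  rewrite -[m]addn0; apply: (IH m 0%N (fun a => r * u a - u (r * a))) => //.
  exact: commD.
- rewrite addSn => r /=.
  have H1 : diffop_order (m + m'.+1) (fun a => r * u (v a) - u (r * v a)).
    apply: (IH m m'.+1 (fun a => r * u a - u (r * a))) => //.
    exact: commD.
  have H2 : diffop_order (m + m'.+1) (fun a => u (r * v a - v (r * a))).
    by rewrite addnS -addSn; apply: IH => //; rewrite addSn -addnS.
  by apply: diffop_order_ext (diffop_orderD H1 H2) => a; exact: eqcomm uD a.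
Qed.

End DiffOp.

Record diffop (K : comNzRingType) (A : comAlgType K) := DiffOp {
  diffop_fun :> A -> A;
  diffop_linear : linear diffop_fun;
  diffop_finite_order : exists m, diffop_order m diffop_fun }.

Section DiffOpRing.
Context {K : comNzRingType} {A : comAlgType K}.
Local Notation D := (diffop A).
Implicit Types u v w : D.

HB.instance Definition _ := gen_eqMixin D.
HB.instance Definition _ := gen_choiceMixin D.

Lemma diffopP u v : u =1 v -> u = v.
Proof.
case: u v => [u lu du] [v lv dv] /= /funext e; case: v / e lv dv => lv dv.
by congr DiffOp; exact: Prop_irrelevance.
Qed.

Lemma diffopDE u a b : u (a + b) = u a + u b.
Proof. by have := diffop_linear u 1 a b; rewrite !scale1r. Qed.

Lemma diffop0E u : u 0 = 0.
Proof. by apply: (addrI (u 0)); rewrite -diffopDE !addr0. Qed.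

Lemma diffopZE u c a : u (c *: a) = c *: u a.
Proof. by have := diffop_linear u c a 0; rewrite diffop0E !addr0. Qed.

Program Definition diffop_zero : D := @DiffOp K A (fun=> 0) _ _.
Next Obligation. by move=> c a b; rewrite scaler0 addr0. Qed.
Next Obligation. by exists 0%N; exact: diffop_order0. Qed.

Program Definition diffop_add u v : D := @DiffOp K A (fun a => u a + v a) _ _.
Next Obligation.
by move=> u v c a b; rewrite !diffopDE !diffopZE scalerDr addrACA.
Qed.
Next Obligation.
move=> u v; have [[m Hm] [m' Hm']] :=
  (diffop_finite_order u, diffop_finite_order v).
exists (maxn m m'); apply: diffop_orderD.
- by apply: diffop_orderW Hm; rewrite leq_maxl.
- by apply: diffop_orderW Hm'; rewrite leq_maxr.
Qed.

Program Definition diffop_scale (c : K) u : D :=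
  @DiffOp K A (fun a => c *: u a) _ _.
Next Obligation.
by move=> c u d a b; rewrite diffopDE diffopZE scalerDr !scalerA mulrC.
Qed.
Next Obligation.
move=> c u; have [m Hm] := diffop_finite_order u.
by exists m; exact: diffop_orderZ.
Qed.

Program Definition diffop_one : D := @DiffOp K A id _ _.
Next Obligation. by []. Qed.
Next Obligation. by exists 0%N => r a; rewrite subrr. Qed.

Program Definition diffop_comp u v : D := @DiffOp K A (fun a => u (v a)) _ _.
Next Obligation. by move=> u v c a b; rewrite !(diffopDE, diffopZE). Qed.
Next Obligation.
move=> u v; have [[m Hm] [m' Hm']] :=
  (diffop_finite_order u, diffop_finite_order v).
exists (m + m')%N; apply: diffop_orderM => //; exact: diffopDE.
Qed.

Program Definition diffop_mult (r : A) : D := @DiffOp K A ( *%R r) _ _.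
Next Obligation. by move=> r c a b; rewrite mulrDr scalerAr. Qed.
Next Obligation. by move=> r; exists 0%N => s a; rewrite mulrCA subrr. Qed.

Fact diffop_addA : associative diffop_add.
Proof. by move=> u v w; apply: diffopP => a /=; rewrite addrA. Qed.
Fact diffop_addC : commutative diffop_add.
Proof. by move=> u v; apply: diffopP => a /=; rewrite addrC. Qed.
Fact diffop_add0 : left_id diffop_zero diffop_add.
Proof. by move=> u; apply: diffopP => a /=; rewrite add0r. Qed.
Fact diffop_addN : left_inverse diffop_zero (diffop_scale (-1)) diffop_add.
Proof. by move=> u; apply: diffopP => a /=; rewrite scaleN1r addNr. Qed.

HB.instance Definition _ := GRing.isZmodule.Build D
  diffop_addA diffop_addC diffop_add0 diffop_addN.

Fact diffop_mulA : associative diffop_comp.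
Proof. by move=> u v w; apply: diffopP. Qed.
Fact diffop_mul1 : left_id diffop_one diffop_comp.
Proof. by move=> u; apply: diffopP. Qed.
Fact diffop_mulr1 : right_id diffop_one diffop_comp.
Proof. by move=> u; apply: diffopP. Qed.
Fact diffop_mulDl : left_distributive diffop_comp diffop_add.
Proof. by move=> u v w; apply: diffopP. Qed.
Fact diffop_mulDr : right_distributive diffop_comp diffop_add.
Proof. by move=> u v w; apply: diffopP => a; exact: diffopDE. Qed.
Fact diffop_oner_neq0 : diffop_one != diffop_zero.
Proof.
apply/eqP => /(congr1 (fun u : D => u 1)) /= /eqP.
by rewrite (negPf (oner_neq0 A)).
Qed.

HB.instance Definition _ := GRing.Zmodule_isNzRing.Build D
  diffop_mulA diffop_mul1 diffop_mulr1 diffop_mulDl diffop_mulDr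
  diffop_oner_neq0.

Fact diffop_scaleA c d u :
  diffop_scale c (diffop_scale d u) = diffop_scale (c * d) u.
Proof. by apply: diffopP => a /=; rewrite scalerA. Qed.
Fact diffop_scale1 : left_id 1 diffop_scale.
Proof. by move=> u; apply: diffopP => a /=; rewrite scale1r. Qed.
Fact diffop_scaleDr : right_distributive diffop_scale +%R.
Proof. by move=> c u v; apply: diffopP => a; exact: scalerDr. Qed.
Fact diffop_scaleDl u : {morph diffop_scale^~ u : c d / c + d}.
Proof. by move=> c d; apply: diffopP => a; exact: scalerDl. Qed.

HB.instance Definition _ := GRing.Zmodule_isLmodule.Build K D
  diffop_scaleA diffop_scale1 diffop_scaleDr diffop_scaleDl.

Fact diffop_scaleAl (c : K) u v : c *: (u * v) = (c *: u) * v.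
Proof. by apply: diffopP. Qed.
HB.instance Definition _ := GRing.Lmodule_isLalgebra.Build K D diffop_scaleAl.

Fact diffop_scaleAr (c : K) u v : c *: (u * v) = u * (c *: v).
Proof. by apply: diffopP => a; rewrite /= /diffop_comp /= diffopZE. Qed.
HB.instance Definition _ := GRing.Lalgebra_isAlgebra.Build K D diffop_scaleAr.

End DiffOpRing.

Notation DP1 K := (diffop {poly K}).
Notation DP K n := (diffop {mpoly K[n]}).


(* The additive span of the products a *: v with a in I and v in S. *)
Definition prodspan (R : pzRingType) (V : lmodType R) (I : set R) (S : set V) :
    set V :=
  [set v | exists l : seq (R * V),
     (forall x, x \in l -> I x.1 /\ S x.2) /\ v = \sum_(x <- l) x.1 *: x.2].

Definition lspan (R : pzRingType) (V : lmodType R) (S : set V) : set V :=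
  prodspan setT S.

Section QuotientModule.
Context {R : pzRingType} {V : lmodType R}.
Variable S : set V.

Definition spanpred : {pred V} := fun v => `[< lspan S v >].

Lemma spanpred_submod : submod_closed spanpred.
Proof.
split; first by apply/asboolP; exists [::]; rewrite big_nil.
move=> a _ _ /asboolP[l [Hl ->]] /asboolP[l' [Hl' ->]]; apply/asboolP.
exists ([seq (a * x.1, x.2) | x <- l] ++ l'); split.
  move=> x; rewrite mem_cat => /orP[|/Hl' //].
  by move=> /mapP[y /Hl [_ Sy] ->].
rewrite big_cat big_map scaler_sumr; congr (_ + _).
by apply: eq_bigr => x _; rewrite scalerA.
Qed.
HB.instance Definition _ := GRing.isSubmodClosed.Build R V spanpred
  spanpred_submod.

Definition quotmod : Type := Quotient.quot spanpred.
HB.instance Definition _ := GRing.Zmodule.on quotmod.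

Definition quotmod_pi (v : V) : quotmod := (\pi_(Quotient.quot spanpred) v)%qT.
Definition quotmod_repr (x : quotmod) : V :=
  generic_quotient.repr (x : Quotient.quot spanpred).

Lemma quotmod_piK x : quotmod_pi (quotmod_repr x) = x.
Proof. exact: reprK. Qed.
Lemma quotmod_piP v w : quotmod_pi v = quotmod_pi w <-> lspan S (v - w).
Proof.
split.
  by move=> /eqP; rewrite -Quotient.idealrBE => /asboolP.
by move=> H; apply/eqP; rewrite -Quotient.idealrBE; apply/asboolP.
Qed.
Lemma quotmod_piD v w : quotmod_pi (v + w) = quotmod_pi v + quotmod_pi w.
Proof. exact: Quotient.pi_add. Qed.

Definition quotmod_scale (a : R) (x : quotmod) : quotmod :=
  quotmod_pi (a *: quotmod_repr x).

Lemma quotmod_piZ a v : quotmod_pi (a *: v) = quotmod_scale a (quotmod_pi v).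
Proof.
apply/quotmod_piP; rewrite -scalerBr; apply/asboolP.
have H : v - quotmod_repr (quotmod_pi v) \in spanpred.
  by apply/asboolP/quotmod_piP; rewrite quotmod_piK.
exact: (rpredZ a H).
Qed.

Fact quotmod_scaleA a b x :
  quotmod_scale a (quotmod_scale b x) = quotmod_scale (a * b) x.
Proof. by rewrite -[x]quotmod_piK -!quotmod_piZ scalerA. Qed.
Fact quotmod_scale1 : left_id 1 quotmod_scale.
Proof. by move=> x; rewrite -[x]quotmod_piK -!quotmod_piZ scale1r. Qed.
Fact quotmod_scaleDr : right_distributive quotmod_scale +%R.
Proof.
move=> a x y; rewrite -[x]quotmod_piK -[y]quotmod_piK.
rewrite -[in LHS]quotmod_piD -!quotmod_piZ scalerDr; exact: quotmod_piD.
Qed.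
Fact quotmod_scaleDl x : {morph quotmod_scale^~ x : a b / a + b}.
Proof.
move=> a b; rewrite -[x]quotmod_piK -!quotmod_piZ scalerDl.
exact: quotmod_piD.
Qed.
HB.instance Definition _ := GRing.Zmodule_isLmodule.Build R quotmod
  quotmod_scaleA quotmod_scale1 quotmod_scaleDr quotmod_scaleDl.

End QuotientModule.
Arguments quotmod {R V} S.

Definition cyclic_module (R : pzRingType) (M : lmodType R) : Prop :=
  exists m : M, lspan [set m] = setT.

(* M is the cokernel of a map from a free module of finite rank to R^m. *)
Definition finitely_presented (R : nzRingType) (M : lmodType R) : Prop :=
  exists (m : nat) (S : seq 'rV[R]_m) (f : {linear 'rV[R]_m -> M}),
    (forall y, exists x, f x = y) /\
    (forall x, f x = 0 <-> lspan [set` S] x).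

Definition restr (K : comNzRingType) (A : lalgType K) (M : lmodType A) : Type :=
  M.

Section Restriction.
Context {K : comNzRingType} {A : lalgType K} {M : lmodType A}.
Definition restr_scale (c : K) (m : restr M) : restr M := c%:A *: (m : M).

HB.instance Definition _ := GRing.Zmodule.copy (restr M) M.

Fact restr_scaleA a b m :
  restr_scale a (restr_scale b m) = restr_scale (a * b) m.
Proof. by rewrite /restr_scale scalerA -scalerAl mul1r scalerA. Qed.
Fact restr_scale1 : left_id 1 restr_scale.
Proof. by move=> m; rewrite /restr_scale scale1r scale1r. Qed.
Fact restr_scaleDr : right_distributive restr_scale +%R.
Proof. by move=> a m m'; exact: (scalerDr (a%:A : A)). Qed.
Fact restr_scaleDl m : {morph restr_scale^~ m : a b / a + b}.
Proof. by move=> a b; rewrite /restr_scale scalerDl; exact: scalerDl. Qed.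
HB.instance Definition _ := GRing.Zmodule_isLmodule.Build K (restr M)
  restr_scaleA restr_scale1 restr_scaleDr restr_scaleDl.
End Restriction.


Definition balanced (T S : nzRingType) (phi : T -> S) (N : lmodType T)
    (G : zmodType) (f : S -> N -> G) : Prop :=
  [/\ forall a b x, f (a + b) x = f a x + f b x,
      forall a x y, f a (x + y) = f a x + f a y &
      forall a c x, f (a * phi c) x = f a (c *: x)].

(* M, with (a, x) |-> t a x, is the left S-module S (x)_T N, where S is seen  *)
(* as an (S, T)-bimodule through phi.                                         *)
Definition is_base_change (T S : nzRingType) (phi : T -> S) (N : lmodType T)
    (M : lmodType S) (t : S -> N -> M) : Prop :=
  [/\ balanced phi t,
      forall a b x, t (a * b) x = a *: t b x &
      forall (G : zmodType) (f : S -> N -> G), balanced phi f ->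
        exists g : {additive M -> G}, (forall a x, g (t a x) = f a x) /\
          forall h : {additive M -> G},
            (forall a x, h (t a x) = f a x) -> h =1 g].

Definition multilinear (K : comNzRingType) (I : eqType) (V_ : I -> lmodType K)
    (W : lmodType K) (f : (forall i, V_ i) -> W) : Prop :=
  forall (v : forall i, V_ i) (i : I) (c : K) (x y : V_ i),
    f (dfwith v (c *: x + y)) = c *: f (dfwith v x) + f (dfwith v y).

Definition is_tensor (K : comNzRingType) (I : eqType) (V_ : I -> lmodType K)
    (W : lmodType K) (t : (forall i, V_ i) -> W) : Prop :=
  multilinear t /\
  forall (U : lmodType K) (f : (forall i, V_ i) -> U), multilinear f ->
    exists g : {linear W -> U}, (forall v, g (t v) = f v) /\
      forall h : {linear W -> U}, (forall v, h (t v) = f v) -> h =1 g.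

Section PolynomialRings.
Context {K : fieldType}.

(* u = d_0 (x) ... (x) d_(n-1) under D(P_n) = D(P_1)^{(x) n}; the pure tensor *)
(* q_0 (x) ... (x) q_(n-1) of P_n = P_1^{(x) n} is prod_i q_i('X_i).          *)
Definition is_tensor_op n (d : 'I_n -> DP1 K) (u : DP K n) : Prop :=
  forall q : 'I_n -> {poly K},
    u (\prod_(i < n) horner_alg 'X_i (q i)) =
    \prod_(i < n) horner_alg 'X_i (d i (q i)).

(* The D(P_n)-module M is the tensor product over K of the D(P_1)-modules    *)
(* M_ 0, ..., M_ (n - 1).                                                    *)
Definition is_outer_tensor n (M_ : 'I_n -> lmodType (DP1 K))
    (M : lmodType (DP K n)) (t : (forall i, restr (M_ i)) -> restr M) : Prop :=
  is_tensor t /\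
  forall (d : 'I_n -> DP1 K) (u : DP K n), is_tensor_op d u ->
    forall v : forall i, M_ i, u *: (t v : M) = t (fun i => d i *: v i).

(* u = x^a d^[b] *)
Definition is_monomial_op n (a b : 'X_{1..n}) (u : DP K n) : Prop :=
  forall c : 'X_{1..n},
    u 'X_[c] = (\prod_(i < n) 'C(c i, b i))%:R *: 'X_[(a + (c - b))%MM].

Definition canonical_filtration n (i : nat) : set (DP K n) :=
  lspan [set u | exists a b : 'X_{1..n},
                   (mdeg a + mdeg b <= i)%N /\ is_monomial_op a b u].

End PolynomialRings.
Arguments is_outer_tensor {K n} M_ M t.

Section Dimension.
Context {K : fieldType}.

Definition has_dim (V : lmodType K) (W : set V) (d : nat) : Prop :=
  exists b : 'I_d -> V,
    (forall c : 'I_d -> K, \sum_i c i *: b i = 0 -> forall i, c i = 0) /\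
    W = [set v | exists c : 'I_d -> K, v = \sum_i c i *: b i].

(* Junk value 0 if W is not a finite-dimensional subspace. *)
Definition dimK (V : lmodType K) (W : set V) : nat :=
  xget 0%N [set d | has_dim W d].

Context {n : nat}.
Implicit Type M : lmodType (DP K n).

Definition generating_subspace M (M0 : set M) : Prop :=
  (exists d, has_dim (M0 : set (restr M)) d) /\ lspan M0 = setT.

Definition hilbert M (M0 : set M) (i : nat) : nat :=
  dimK (prodspan (canonical_filtration i) M0 : set (restr M)).

Definition growth (R : realType) (f : nat -> nat) : \bar R :=
  ereal_inf [set r%:E | r in
    [set r : R | 0 <= r /\ \forall i \near \oo, (f i)%:R <= i%:R `^ r]].

(* Dim(M) = D and e(M) = e are required for all choices of M0 at once, which *)
(* builds in that they do not depend on this choice.                         *)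
Definition has_Dim (R : realType) M (D : \bar R) : Prop :=
  (exists M0 : set M, generating_subspace M0) /\
  forall M0 : set M, generating_subspace M0 -> growth R (hilbert M0) = D.

Definition has_multiplicity (R : realType) M (e : R) : Prop :=
  exists D : nat, has_Dim M (D%:R%:E : \bar R) /\
    forall M0 : set M, generating_subspace M0 ->
      ((fun i => (hilbert M0 i)%:R) : nat -> R) =
      (fun i => e / D`!%:R * i%:R ^+ D) +o_\oo (fun i => i%:R ^+ D : R).

Definition holonomic M : Prop :=
  (exists m : M, m != 0) /\
  exists M0 : set M, generating_subspace M0 /\
    exists q : {poly rat}, size q = n.+1 /\
      \forall i \near \oo, (hilbert M0 i)%:R <= q.[i%:R].

End Dimension.


(* u lies in sum_(j < q) d^[j] K[x]; g^`N(j) is the divided derivative       *)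
(* d^[j] g.                                                                  *)
Definition Tform (K : fieldType) (q : nat) (u : {poly K} -> {poly K}) : Prop :=
  exists f : nat -> {poly K}, forall g, u g = \sum_(j < q) (f j * g)^`N(j).

Section Tform.
Context {K : fieldType} {p : nat} (hp : p \in [pchar K]).
Variable k : nat.
Local Notation q := (p ^ k)%N.
Implicit Types u v : {poly K} -> {poly K}.

Lemma Tform_ext u v : u =1 v -> Tform q u -> Tform q v.
Proof. by move=> /funext ->. Qed.

Lemma Tform0 : Tform q (fun=> 0 : {poly K}).
Proof.
by exists (fun=> 0) => g; rewrite big1 // => j _; rewrite mul0r linear0.
Qed.

Lemma TformD u v : Tform q u -> Tform q v -> Tform q (fun g => u g + v g).
Proof.
move=> [f Hf] [f' Hf']; exists (fun j => f j + f' j) => g.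
rewrite Hf Hf' -big_split /=; apply: eq_bigr => j _.
by rewrite mulrDl linearD.
Qed.

Lemma TformZ c u : Tform q u -> Tform q (fun g => c *: u g).
Proof.
move=> [f Hf]; exists (fun j => c *: f j) => g.
rewrite Hf scaler_sumr; apply: eq_bigr => j _.
by rewrite -scalerAl linearZ.
Qed.

Lemma Tform_sum (I : Type) (r : seq I) (u_ : I -> {poly K} -> {poly K}) :
  (forall i, Tform q (u_ i)) -> Tform q (fun g => \sum_(i <- r) u_ i g).
Proof.
move=> H; elim: r => [|i r IH].
  by apply: Tform_ext Tform0 => g; rewrite big_nil.
by apply: Tform_ext (TformD (H i) IH) => g; rewrite big_cons.
Qed.

Lemma Tform1 (j : nat) (f : {poly K}) :
  (j < q)%N -> Tform q (fun g => (f * g)^`N(j)).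
Proof.
move=> jq; exists (fun i => if i == j then f else 0) => g.
rewrite (bigD1 (Ordinal jq)) //= eqxx big1 ?addr0 // => i ij.
by rewrite ifF ?mul0r ?linear0 //; apply/negbTE.
Qed.

Lemma TformX u : Tform q u -> Tform q (fun g => 'X * u g).
Proof.
move=> [f Hf].
have H : forall j : 'I_q, Tform q (fun g => 'X * (f j * g)^`N(j)).
  case=> j /= jq.
  have XN (h : {poly K}) i :
      'X * h^`N(i.+1) = ('X * h)^`N(i.+1) - h^`N(i).
    have := nderivnMXaddC i h 0; rewrite !addr0 ![_ * 'X]mulrC => ->.
    by rewrite addrC addKr.
  case: j jq => [|j] jq.
    apply: Tform_ext (Tform1 ('X * f 0%N) jq) => g.
    by rewrite !nderivn0 mulrA.
  have := TformD (Tform1 ('X * f j.+1) jq)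
                 (TformZ (-1) (Tform1 (f j.+1) (ltnW jq))).
  by apply: Tform_ext => g; rewrite XN scaleN1r mulrA.
apply: Tform_ext (Tform_sum (index_enum 'I_q) H) => g.
by rewrite Hf mulr_sumr.
Qed.

Lemma TformM h u : Tform q u -> Tform q (fun g => h * u g).
Proof.
elim/poly_ind: h u => [|h c IH] u Hu.
  by apply: Tform_ext Tform0 => g; rewrite mul0r.
apply: Tform_ext (TformD (IH _ (TformX Hu)) (TformZ c Hu)) => g.
by rewrite mulrDl mulrA mul_polyC.
Qed.

Lemma natr_bin_pchar_eq0 i j :
  (i < q)%N -> (j < q)%N -> (q <= i + j)%N -> 'C(i + j, i)%:R = 0 :> K.
Proof.
move=> iq jq qij.
have hP : p \in [pchar {poly K}] by rewrite pchar_poly.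
have coefE m l : (('X + 1) ^+ m : {poly K})`_l = 'C(m, l)%:R.
  rewrite exprD1n coef_sum.
  have [lm|ml] := ltnP l m.+1; last first.
    rewrite bin_small // big1 // => s _; rewrite coefMn coefXn.
    by rewrite gtn_eqF ?mul0rn // (leq_trans (ltn_ord s)).
  rewrite (bigD1 (Ordinal lm)) //= coefMn coefXn eqxx big1 ?addr0 // => s sl.
  rewrite coefMn coefXn; case: eqP => [e|_]; last by rewrite mul0rn.
  by case/negP: sl; apply/eqP/val_inj.
rewrite -coefE -(subnKC qij) exprD.
have -> : (('X + 1) ^+ q : {poly K}) = 'X^q + 1.
  rewrite (@exprDn_pchar _ 'X 1 q) ?expr1n //.
  by rewrite pnatX (eq_pnat _ (pcharf_eq hP)) pnat_id ?(pcharf_prime hP).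
rewrite mulrDl mul1r coefD coefXnM iq add0r coefE bin_small //.
by rewrite ltn_subLR // addnC ltn_add2r.
Qed.

Lemma nderivn_comp (h : {poly K}) i j :
  h^`N(j)^`N(i) = h^`N(i + j) *+ 'C(i + j, i).
Proof.
apply/polyP => l; rewrite coefMn !coef_nderivn -!mulrnA addnCA addnA.
congr (_ *+ _).
have e0 : (0 < i`! * j`! * l`!)%N by rewrite !muln_gt0 !fact_gt0.
apply/eqP; rewrite -(eqn_pmul2r e0); apply/eqP.
have Hil := @bin_fact (i + l) i (leq_addr _ _).
have Hj := @bin_fact (j + (i + l)) j (leq_addr _ _).
have Hij := @bin_fact (i + j) i (leq_addr _ _).
have Hl := @bin_fact (i + j + l) (i + j) (leq_addr _ _).
rewrite !addKn in Hil Hj Hij Hl.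
rewrite addnCA addnA in Hj.
transitivity (i + j + l)`!; first by rewrite -Hj -Hil; lia.
by rewrite -Hl -Hij; lia.
Qed.

Lemma TformN i u : (i < q)%N -> Tform q u -> Tform q (fun g => (u g)^`N(i)).
Proof.
move=> iq [f Hf].
have H : forall j : 'I_q, Tform q (fun g => (f j * g)^`N(j)^`N(i)).
  case=> j /= jq; have [ijq|qij] := ltnP (i + j) q.
    have := TformZ ('C(i + j, i)%:R) (Tform1 (f j) ijq).
    by apply: Tform_ext => g; rewrite nderivn_comp scaler_nat.
  apply: Tform_ext Tform0 => g.
  by rewrite nderivn_comp -scaler_nat natr_bin_pchar_eq0 // scale0r.
apply: Tform_ext (Tform_sum (index_enum 'I_q) H) => g.
by rewrite Hf linear_sum.
Qed.

Lemma Tform_comp u v : Tform q u -> Tform q v -> Tform q (fun g => u (v g)).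
Proof.
move=> [f Hf] Hv.
have H : forall j : 'I_q, Tform q (fun g => (f j * v g)^`N(j)).
  by move=> j; apply: TformN => //; exact: TformM.
apply: Tform_ext (Tform_sum (index_enum 'I_q) H) => g.
by rewrite Hf.
Qed.

Lemma Tform_id : Tform q (fun g : {poly K} => g).
Proof.
have q0 : (0 < q)%N by rewrite expn_gt0 prime_gt0 ?(pcharf_prime hp).
by apply: Tform_ext (Tform1 1 q0) => g; rewrite nderivn0 mul1r.
Qed.

Definition Tpred : {pred DP1 K} := fun u : DP1 K => `[< Tform q u >].

Lemma Tpred_subring : subring_closed Tpred.
Proof.
split; first by apply/asboolP; exact: Tform_id.
  move=> u v /asboolP Hu /asboolP Hv; apply/asboolP.
  exact: TformD Hu (TformZ (-1) Hv).
by move=> u v /asboolP Hu /asboolP Hv; apply/asboolP; exact: Tform_comp.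
Qed.

End Tform.

(* hp is an argument so that the ring structure below can be inferred. *)
Definition Tkpred (K : fieldType) (p : nat) (hp : p \in [pchar K]) (k : nat) :
    {pred DP1 K} := @Tpred K p k.
HB.instance Definition _ (K : fieldType) (p : nat) (hp : p \in [pchar K])
    (k : nat) :=
  GRing.isSubringClosed.Build (DP1 K) (Tkpred hp k) (Tpred_subring hp k).

Record Tk (K : fieldType) (p : nat) (hp : p \in [pchar K]) (k : nat) :=
  MkTk { Tk_val :> DP1 K; Tk_valP : Tk_val \in Tkpred hp k }.

Section ModuleMks.
Context {K : fieldType} {p : nat} (hp : p \in [pchar K]).
Variable k : nat.

HB.instance Definition _ := [isSub for @Tk_val K p hp k].
HB.instance Definition _ := [Choice of Tk hp k by <:].
HB.instance Definition _ := [SubChoice_isSubNzRing of Tk hp k by <:].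

Definition Lambda_plus : set (Tk hp k) :=
  [set u | exists c : nat -> K, forall g : {poly K},
             (u : DP1 K) g = \sum_(1 <= j < p ^ k) c j *: g^`N(j)].

Definition Tk_quotient : lmodType (Tk hp k) :=
  quotmod (Lambda_plus : set (Tk hp k)^o).

Definition is_Mk (M : lmodType (DP1 K)) : Prop :=
  exists t : DP1 K -> Tk_quotient -> M, is_base_change (@Tk_val K p hp k) t.

Definition Lambda_m1 : lmodType (DP1 K) :=
  quotmod ([set diffop_mult ('X : {poly K})] : set (DP1 K)^o).

(* The D(P_1)-modules M(k), D(P_1) (s times), Lambda_{-1} (n - s - 1 times)  *)
(* whose outer tensor product is M(k, s).                                    *)
Definition Mks_factor (Mk : lmodType (DP1 K)) (s i : nat) : lmodType (DP1 K) :=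
  if i == 0%N then Mk
  else if (i <= s)%N then (DP1 K)^o : lmodType (DP1 K)
  else Lambda_m1.

Definition is_Mks (n s : nat) (M : lmodType (DP K n)) : Prop :=
  exists2 Mk : lmodType (DP1 K), is_Mk Mk &
    exists t, is_outer_tensor (fun i : 'I_n => Mks_factor Mk s i) M t.

End ModuleMks.

(* Main.v *)
From HB Require Import structures.
Require Import Defs.
From mathcomp Require Import all_boot all_order all_algebra.
From mathcomp Require Import mpoly zify lra.
From mathcomp Require Import boolp classical_sets functions reals ereal topology.
From mathcomp Require Import normedtype landau realfun exp.

(* The divided powers d^[b], together with Lucas' congruences for q = p^k,    *)
(* show that the left ideal of D(P_1) generated by the d^[j], 0 < j < q, is   *)
(* spanned by the x^a d^[b] with q not dividing b. Hence M(k) has the basis   *)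
(* x^a d^[q b], and Lambda_{-1} has the basis d^[b]. An outer tensor product  *)
(* of the D(P_1)/J_i is D(P_n)/J for J generated by all the J_i, so M(k, s)   *)
(* has a basis of "good" monomials x^alpha d^[beta], alpha supported in       *)
(* {0, ..., s} and q dividing beta_0. Reduction modulo J does not raise the   *)
(* weight |alpha| + |beta|, so dim F_i e is the number N(i) of good monomials *)
(* of weight <= i for the canonical generator e. Splitting off the remainder  *)
(* of beta_0 modulo q gives i^D <= D! q N(i) <= (i + D + q)^D, where          *)
(* D = n + 1 + s. The functions dim F_i M_0 and N(i) differ at most by shifts *)
(* of the argument, which yields Dim = D and e = 1/q for every M_0.           *)

Set Implicit Arguments.
Unset Strict Implicit.
Unset Printing Implicit Defensive.

Import Order.TTheory GRing.Theory Num.Theory.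
Import numFieldNormedType.Exports.
Local Open Scope ring_scope.

(** * Linear extension from a basis *)

(** Put q = p^k. In characteristic p the left ideal of D(P_1) generated by the d^[j], 0 < j < q,
    contains every x^a d^[b] with q not dividing b, because d^[qm] d^[r] = d^[qm+r] for 0 < r < q.
    It contains no combination of the remaining x^a d^[b], because d^[b] d^[j] = 0 when 0 < j < q
    and q divides b + j. So one divided power out of q consecutive ones survives in M(k), and this
    density is the multiplicity 1/q. The other factors only contribute free exponents: M(k) and each
    copy of D(P_1) give two, each Lambda_{-1} gives one, in total 2 + 2s + (n-s-1) = n+1+s. The
    argument is carried by three groups of lemmas. [mop_spanning] and [mop_free] give the monomial
    basis of the rings of differential operators; [is_Mk_presents] and [outer_tensor_presents] turn
    the universal properties of base change and tensor product into a cyclic presentation of M(k,s).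
    [mgood_red] and [mgood_dual] give normal forms compatible with the filtration, so that
    [presents_has_dim] identifies the Hilbert function of the canonical generator with a lattice
    point count, bounded in [card_good_bounds]. [hilbert_sandwich] transfers the bounds to every
    generating subspace, and [growth_asymptotic], [littleo_asymptotic] and [not_poly_bounded] read
    off dimension, multiplicity and non-holonomicity. Letting k grow makes the multiplicity
    arbitrarily small. *)

Definition linear_of (K : nzRingType) (V W : lmodType K) (g : V -> W)
    (glin : linear g) : {linear V -> W} :=
  HB.pack_for {linear V -> W} g (GRing.isLinear.Build K V W *:%R g glin).

Definition additive_of (V W : zmodType) (g : V -> W)
    (gadd : forall x y, g (x - y) = g x - g y) : {additive V -> W} :=
  HB.pack_for {additive V -> W} g (GRing.isZmodMorphism.Build V W g gadd).

Section Families.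
Context {K : fieldType} {V : lmodType K} {I : eqType}.
Implicit Types (b : I -> V) (l : seq (K * I)).

(** A combination is a list that may repeat an index, so freeness must speak of the collected
    coefficients [lcoef]. *)
Definition lincomb b l : V := \sum_(x <- l) x.1 *: b x.2.
Definition lcoef l (i : I) : K := \sum_(x <- l | x.2 == i) x.1.
Definition spanning b := forall v, exists l, v = lincomb b l.
Definition free_family b :=
  forall l, lincomb b l = 0 -> forall i, lcoef l i = 0.

Lemma lincomb_group b l (P : pred I) :
  \sum_(x <- l | P x.2) x.1 *: b x.2 =
  \sum_(i <- undup [seq x.2 | x <- l] | P i) lcoef l i *: b i.
Proof.
under [RHS]eq_bigr do rewrite /lcoef scaler_suml.
rewrite (exchange_big_dep (fun x : K * I => P x.2)) /=; last first.
  by move=> i x Pi /eqP ->.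
rewrite big_seq_cond [RHS]big_seq_cond; apply: eq_bigr => x /andP[xl Px].
rewrite big_mkcond (bigD1_seq x.2) ?undup_uniq ?mem_undup ?map_f //= Px eqxx.
by rewrite big1 ?addr0 // => i ix; rewrite [x.2 == i]eq_sym (negPf ix) andbF.
Qed.

Lemma lincomb_cat b l l' : lincomb b (l ++ l') = lincomb b l + lincomb b l'.
Proof. exact: big_cat. Qed.

Lemma lincombZ b c l :
  lincomb b [seq (c * x.1, x.2) | x <- l] = c *: lincomb b l.
Proof.
rewrite /lincomb big_map scaler_sumr.
by apply: eq_bigr => x _; rewrite scalerA.
Qed.

Lemma lincomb1 b i : lincomb b [:: (1, i)] = b i.
Proof. by rewrite /lincomb big_seq1 scale1r. Qed.

Lemma linear_lincomb (W : lmodType K) (f : {linear V -> W}) b l :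
  f (lincomb b l) = \sum_(x <- l) x.1 *: f (b x.2).
Proof. by rewrite linear_sum; apply: eq_bigr => x _; rewrite linearZ. Qed.

Lemma spanning_eq (W : lmodType K) b (f g : {linear V -> W}) :
  spanning b -> (forall i, f (b i) = g (b i)) -> f =1 g.
Proof.
move=> sp fg v; have [l ->] := sp v; rewrite !linear_lincomb.
by apply: eq_bigr => x _; rewrite fg.
Qed.

End Families.

Lemma linear_extension (K : fieldType) (V W : lmodType K) (I : eqType)
    (b : I -> V) (w : I -> W) :
  spanning b -> free_family b ->
  exists g : {linear V -> W}, forall i, g (b i) = w i.
Proof.
move=> sp fr.
have wd l l' : lincomb b l = lincomb b l' -> lincomb w l = lincomb w l'.
  move=> e; set l2 := l ++ [seq (-1 * x.1, x.2) | x <- l'].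
  have l20 : lincomb b l2 = 0 by rewrite lincomb_cat lincombZ e scaleN1r subrr.
  have : lincomb w l2 = 0.
    rewrite /lincomb (lincomb_group w l2 predT) big1 // => i _.
    by rewrite fr ?scale0r.
  by rewrite lincomb_cat lincombZ scaleN1r => /eqP; rewrite subr_eq0 => /eqP.
pose rep v := projT1 (cid (sp v)).
have repE v : lincomb b (rep v) = v by rewrite /rep; case: cid.
pose g v := lincomb w (rep v).
have glin : linear g.
  move=> c u v; rewrite /g -lincombZ -lincomb_cat; apply: wd.
  by rewrite lincomb_cat lincombZ !repE.
exists (linear_of glin) => i.
by rewrite -(lincomb1 w) /g; apply: wd; rewrite repE lincomb1.
Qed.

(** * Monomial operators with divided powers *)

Lemma submm_id n (c : 'X_{1..n}) : (c - c = 0)%MM.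
Proof. by apply/mnmP => i; rewrite mnmBE mnm0E subnn. Qed.

Definition mbin n (c b : 'X_{1..n}) : nat := \prod_(i < n) 'C(c i, b i).

Lemma mbin_small n (c b : 'X_{1..n}) : ~~ (b <= c)%MM -> mbin c b = 0%N.
Proof.
move=> /mnm_lepP/existsNP[i /negP ib].
by rewrite /mbin (bigD1 i) //= bin_small ?mul0n // ltnNge.
Qed.

Lemma mbin0 n (c : 'X_{1..n}) : mbin c 0%MM = 1%N.
Proof. by rewrite /mbin big1 // => i _; rewrite mnm0E bin0. Qed.

Lemma mbinn n (c : 'X_{1..n}) : mbin c c = 1%N.
Proof. by rewrite /mbin big1 // => i _; rewrite binn. Qed.

(** A nonzero coefficient forces [b <= c], and then the degrees force equality. This makes the
    action of the d^[b] on monomials unitriangular by degree. *)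
Lemma mbin_deg n (c b : 'X_{1..n}) :
  (mdeg c <= mdeg b)%N -> mbin c b = (c == b).
Proof.
move=> cb; have [->|neq] := eqVneq c b; first exact: mbinn.
apply: mbin_small; apply: contraNN neq => bc.
rewrite -(submK bc) mdegD -[leqRHS]add0n leq_add2r leqn0 mdeg_eq0 in cb.
by rewrite -(submK bc) (eqP cb) add0m.
Qed.

(** In each coordinate, multiplying by y! z! (x-y-z)! turns both sides into x!. This is the
    composition law d^[b] d^[b'] = C(b+b', b) d^[b+b'] read on coefficients. *)
Lemma mbin_mul n (c b b' : 'X_{1..n}) :
  (mbin c b' * mbin (c - b')%MM b)%N =
  (mbin (b + b')%MM b * mbin c (b + b')%MM)%N.
Proof.
rewrite /mbin -!big_split; apply: eq_bigr => i _ /=.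
rewrite mnmBE mnmDE; set x := c i; set y := b i; set z := b' i.
have [lt|zx] := ltnP x z.
  by rewrite (bin_small lt) (@bin_small x (y + z)) ?muln0 //; lia.
have [lt|le] := ltnP x (y + z).
  by rewrite (bin_small lt) (@bin_small (x - z) y) ?muln0 //; lia.
have e0 : (0 < y`! * z`! * (x - (y + z))`!)%N by rewrite !muln_gt0 !fact_gt0.
apply/eqP; rewrite -(eqn_pmul2r e0); apply/eqP.
have H1 := @bin_fact x z ltac:(lia).
have H2 := @bin_fact (x - z) y ltac:(lia).
have H3 := @bin_fact x (y + z) le.
have H4 := @bin_fact (y + z) y (leq_addr _ _).
rewrite addKn in H4; rewrite subnAC -subnDA in H2.
transitivity x`!; first by rewrite -H1 -H2; lia.
by rewrite -H3 -H4; lia.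
Qed.

(** Pascal's rule in the coordinate [k]; it is the source of the commutation relation [mop_mulX]. *)
Lemma mbinU n (c b : 'X_{1..n}) (k : 'I_n) : (0 < b k)%N ->
  mbin (c + U_(k))%MM b = (mbin c b + mbin c (b - U_(k))%MM)%N.
Proof.
move=> bk; rewrite /mbin (bigD1 k) //= [in RHS](bigD1 k) //=.
rewrite [X in _ = (_ + X)%N](bigD1 k) //=.
rewrite mnmDE mnmBE mnm1E eqxx addn1 subn1 -{1}(prednK bk) binS (prednK bk).
rewrite mulnDl; congr (_ * _ + _ * _)%N; apply: eq_bigr => i ik.
  by rewrite mnmDE mnm1E eq_sym (negPf ik) addn0.
by rewrite mnmDE mnmBE mnm1E eq_sym (negPf ik) addn0 subn0.
Qed.

Lemma mbinU0 n (c b : 'X_{1..n}) (k : 'I_n) : b k = 0%N ->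
  mbin (c + U_(k))%MM b = mbin c b.
Proof.
move=> bk; apply: eq_bigr => i _; rewrite mnmDE mnm1E.
by case: eqP => [<-|_]; rewrite ?bk ?bin0 ?addn0.
Qed.

Lemma mnm_indU n (P : 'X_{1..n} -> Prop) :
  P 0%MM -> (forall c k, P c -> P (U_(k) + c)%MM) -> forall c, P c.
Proof.
move=> P0 PU c; have [m] := ubnP (mdeg c); elim: m c => // m IH c cm.
have [->//|] := eqVneq c 0%MM; rewrite -mdeg_eq0 => c0.
have [k ck] : exists k, (0 < c k)%N.
  apply: contrapT; rewrite -forallNP => H; case/negP: c0.
  by rewrite mdeg_eq0; apply/eqP/mnmP => i; rewrite mnm0E; have := H i; lia.
have Ukc : (U_(k) <= c)%MM.
  by apply/mnm_lepP => i; rewrite mnm1E; case: eqP => // <-.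
rewrite -(submK Ukc) addmC; apply/PU/IH.
have := cm; rewrite -{1}(submK Ukc) mdegD mdeg1; lia.
Qed.

(* A K-basis of A indexed by exponents and multiplicative in them: a common   *)
(* setting for {poly K} (one variable) and {mpoly K[n]}.                      *)
Record mbasis (K : fieldType) (A : comAlgType K) (n : nat) := MBasis {
  mX :> 'X_{1..n} -> A;
  mX0 : mX 0%MM = 1;
  mXD : forall c d, mX (c + d)%MM = mX c * mX d;
  mX_span : spanning mX;
  mX_free : free_family mX }.

Section Evaluation.
Context {K : comNzRingType} {A : comAlgType K}.
Implicit Types u v : diffop A.

Lemma diffop_mulE u v x : (u * v) x = u (v x).
Proof. by []. Qed.

Lemma diffop_addE u v x : (u + v) x = u x + v x.
Proof. by []. Qed.

Lemma diffop_scaleE c u x : (c *: u) x = c *: u x.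
Proof. by []. Qed.

Lemma diffop_sumE I (r : seq I) (P : pred I) (F : I -> diffop A) x :
  (\sum_(i <- r | P i) F i) x = \sum_(i <- r | P i) F i x.
Proof.
elim: r => [|i r IH]; first by rewrite !big_nil.
by rewrite !big_cons; case: ifP => _; rewrite ?diffop_addE IH.
Qed.

End Evaluation.

Section MonomialOperators.
Context {K : fieldType} {A : comAlgType K} {n : nat} (X : mbasis A n).
Implicit Types (a b c : 'X_{1..n}) (u v : diffop A).

Lemma commutator_linear r (g : A -> A) : linear g ->
  linear (fun x => r * g x - g (r * x)).
Proof.
move=> gl c x y; rewrite gl !mulrDr -!scalerAr gl scalerBr.
by rewrite opprD addrACA.
Qed.

Lemma linear_fun0 (g : A -> A) : linear g -> g 0 = 0.
Proof. by move=> gl; have := gl (-1) 0 0; rewrite scaler0 addr0 scaleN1r addNr. Qed.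

Lemma linear_eqX (f g : A -> A) : linear f -> linear g ->
  (forall c, f (X c) = g (X c)) -> f =1 g.
Proof.
move=> fl gl fg.
exact: (spanning_eq (f := linear_of fl) (g := linear_of gl) (mX_span X) fg).
Qed.

(** It suffices to test commutators with the variables: [x_k x^c, g] = x_k [x^c, g] + [x_k, g] x^c
    gives all monomials by induction, and linearity gives all of [A]. *)
Lemma diffop_order_commX m (g : A -> A) : linear g ->
  (forall k, diffop_order m (fun x => X U_(k)%MM * g x - g (X U_(k)%MM * x))) ->
  diffop_order m.+1 g.
Proof.
move=> gl gX.
have H c : diffop_order m (fun x => X c * g x - g (X c * x)).
  elim/mnm_indU: c => [|c k IH].
    by apply: (diffop_order_ext _ (diffop_order0 m)) => x; rewrite mX0 !mul1r subrr.
  have H1 := @diffop_orderM K A 0 m (fun x => X U_(k)%MM * x) _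
    (fun _ _ => mulrDr _ _ _) (fun r x => _) IH.
  have H2 := @diffop_orderM K A m 0 _ (fun x => X c * x) _ (gX k) (fun r x => _).
  rewrite add0n in H1; rewrite addn0 in H2.
  apply: (diffop_order_ext _ (diffop_orderD (H1 _) (H2 _ _))).
  - by move=> x; rewrite mXD mulrBr addrA subrK !mulrA.
  - by move=> r x; rewrite mulrCA subrr.
  - move=> x y; have := commutator_linear (X U_(k)%MM) gl 1 x y.
    by rewrite !scale1r.
  - by move=> r x; rewrite mulrCA subrr.
move=> r; have [l ->] := mX_span X r; rewrite /lincomb.
elim: l => [|x l IH].
  apply: (diffop_order_ext _ (diffop_order0 m)) => y.
  by rewrite big_nil !mul0r linear_fun0 // subrr.
apply: (diffop_order_ext _ (diffop_orderD (diffop_orderZ x.1 (H x.2)) IH)) => y.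
rewrite big_cons !mulrDl -!scalerAl gl scalerBr opprD addrACA.
by [].
Qed.

(** By Pascal's rule [x_k, x^a d^[b]] = - x^a d^[b - e_k], or 0 if b_k = 0, so each commutator
    lowers |b| by one. *)
Lemma mop_order m a b (g : A -> A) : linear g -> mdeg b = m ->
  (forall c, g (X c) = (mbin c b)%:R *: X (a + (c - b))%MM) ->
  diffop_order m g.
Proof.
elim: m b g => [|m IH] b g gl bm gX.
  move/eqP: bm; rewrite mdeg_eq0 => /eqP b0; rewrite b0 in gX.
  have gE : g =1 *%R (X a).
    apply: linear_eqX => // [c x y|c]; first by rewrite mulrDr scalerAr.
    by rewrite gX mbin0 scale1r subm0 mXD.
  by move=> r x; rewrite !gE mulrCA subrr.
apply: diffop_order_commX => // k.
have gl' := commutator_linear (X U_(k)%MM) gl.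
have comX c : X U_(k)%MM * g (X c) - g (X U_(k)%MM * X c) =
    if (0 < b k)%N then
      - ((mbin c (b - U_(k))%MM)%:R *: X (a + (c - (b - U_(k))))%MM) else 0.
  rewrite -mXD addmC !gX -scalerAr -mXD.
  rewrite [(U_(k) + (a + _))%MM]addmC -addmA.
  have [bk|] := ltnP 0 (b k).
    have e : (c - (b - U_(k)) = c + U_(k) - b)%MM.
      apply/mnmP => i; rewrite !(mnmBE, mnmDE) mnm1E.
      by case: eqP => [<-|_]; lia.
    have [bc|/mbin_small bc] := boolP (b <= c)%MM.
      have -> : ((c - b) + U_(k) = c + U_(k) - b)%MM.
        apply/mnmP => i; rewrite !(mnmBE, mnmDE) mnm1E.
        by move/mnm_lepP/(_ i): bc; lia.
      by rewrite mbinU // natrD scalerDl e opprD addrA subrr add0r.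
    by rewrite mbinU // bc add0n e scale0r add0r.
  rewrite leqn0 => /eqP bk; rewrite mbinU0 //.
  have [bc|/mbin_small bc] := boolP (b <= c)%MM; last by rewrite bc !scale0r subrr.
  have -> : ((c - b) + U_(k) = c + U_(k) - b)%MM; last by rewrite subrr.
  apply/mnmP => i; rewrite !(mnmBE, mnmDE) mnm1E.
  by move/mnm_lepP/(_ i): bc; lia.
have [bk|bk] := ltnP 0 (b k); last first.
  apply: (diffop_order_ext _ (diffop_order0 m)).
  apply: linear_eqX => // [c x y|c]; first by rewrite scaler0 addr0.
  by rewrite comX ltnNge bk.
pose h x := -1 *: (X U_(k)%MM * g x - g (X U_(k)%MM * x)).
have hl : linear h.
  by move=> c x y; rewrite /h gl' scalerDr !scalerA mulrC.
have hE : forall c, h (X c) = (mbin c (b - U_(k)))%:R *: X (a + (c - (b - U_(k))))%MM.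
  by move=> c; rewrite /h comX bk scaleN1r opprK.
apply: (diffop_order_ext _ (diffop_orderZ (-1) (IH _ _ hl _ hE))).
  by move=> x; rewrite /h scalerA mulrNN mulr1 scale1r.
have Ub : (U_(k) <= b)%MM.
  by apply/mnm_lepP => i; rewrite mnm1E; case: eqP => // <-.
by have := bm; rewrite -{1}(submK Ub) mdegD mdeg1 addn1 => -[].
Qed.

Lemma mop_exists a b : exists u : diffop A,
  forall c, u (X c) = (mbin c b)%:R *: X (a + (c - b))%MM.
Proof.
have [g gX] := linear_extension
  (fun c => (mbin c b)%:R *: X (a + (c - b))%MM) (mX_span X) (mX_free (m := X)).
have gl : linear g by move=> c x y; rewrite linearP.
have go : exists m, diffop_order m g.
  by exists (mdeg b); apply: mop_order gX.
by exists (DiffOp gl go).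
Qed.

(* x^a d^[b] *)
Definition mop a b : diffop A := projT1 (cid (mop_exists a b)).

Lemma mopE a b c : mop a b (X c) = (mbin c b)%:R *: X (a + (c - b))%MM.
Proof. by rewrite /mop; case: cid. Qed.

Lemma diffop_eqX u v : (forall c, u (X c) = v (X c)) -> u = v.
Proof.
by move=> uv; apply/diffopP/linear_eqX => //; exact: diffop_linear.
Qed.

Lemma mop_mulX a b k :
  mop a b * mop U_(k)%MM 0%MM =
  mop (a + U_(k))%MM b + (if (0 < b k)%N then mop a (b - U_(k))%MM else 0).
Proof.
apply: diffop_eqX => c; rewrite diffop_mulE diffop_addE.
rewrite [mop U_(k)%MM _ _]mopE mbin0 subm0 scale1r mopE addmC.
have -> : (if (0 < b k)%N then mop a (b - U_(k))%MM else 0) (X c) =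
    (if (0 < b k)%N then (mbin c (b - U_(k))%MM)%:R else 0) *:
    X (a + (c + U_(k) - b))%MM.
  case: ltnP => bk; last by rewrite scale0r.
  rewrite mopE; congr (_ *: X (_ + _)%MM); apply/mnmP => i.
  by rewrite !(mnmBE, mnmDE) mnm1E; case: eqP => [<-|_]; lia.
have -> : mop (a + U_(k))%MM b (X c) =
    (mbin c b)%:R *: X (a + (c + U_(k) - b))%MM.
  rewrite mopE; have [bc|/mbin_small ->] := boolP (b <= c)%MM; last by rewrite !scale0r.
  congr (_ *: X _); apply/mnmP => i; rewrite !(mnmBE, mnmDE) mnm1E.
  by move/mnm_lepP/(_ i): bc; lia.
rewrite -scalerDl; congr (_ *: _).
have [bk|] := ltnP 0 (b k); first by rewrite mbinU // natrD.
by rewrite leqn0 => /eqP bk; rewrite mbinU0 // addr0.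
Qed.

Lemma mop_mulD a b b' :
  mop a b * mop 0%MM b' = (mbin (b + b')%MM b)%:R *: mop a (b + b')%MM.
Proof.
apply: diffop_eqX => c.
rewrite diffop_mulE diffop_scaleE !mopE diffopZE mopE add0m !scalerA.
rewrite -!natrM mbin_mul [(b + b')%MM in X in _ = _ *: X]addmC.
by rewrite submDA.
Qed.

Lemma mop_mult a b : mop a b = diffop_mult (X a) * mop 0%MM b.
Proof.
apply: diffop_eqX => c; rewrite diffop_mulE /= !mopE add0m mXD.
by rewrite scalerAr.
Qed.

Lemma mop00 : mop 0%MM 0%MM = 1.
Proof. by apply: diffop_eqX => c; rewrite mopE mbin0 subm0 add0m scale1r. Qed.

Lemma mop_mult0 a : mop a 0%MM = diffop_mult (X a).
Proof. by rewrite mop_mult mop00 mulr1. Qed.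

(** Induction on the order: the commutators with the variables satisfy the hypothesis one degree
    lower, hence vanish. Then [u] commutes with all variables and is determined by u(1) = 0. *)
Lemma diffop_eq0 m u : diffop_order m u ->
  (forall c, (mdeg c <= m)%N -> u (X c) = 0) -> u = 0.
Proof.
move=> uo u0; apply/diffopP.
have: linear u by exact: diffop_linear.
move: (diffop_fun u) uo u0 => {u}; elim: m => [|m IH] u uo u0 ul.
  move=> x; have /eqP := uo x 1; rewrite mulr1 subr_eq0 => /eqP <-.
  by rewrite -(mX0 X) u0 ?mdeg0 ?mulr0.
have uU k x : X U_(k)%MM * u x = u (X U_(k)%MM * x).
  apply/eqP; rewrite -subr_eq0; apply/eqP.
  move: x; apply: (IH (fun x => X U_(k)%MM * u x - u (X U_(k)%MM * x))).
  - exact: uo.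
  - move=> c cm; rewrite u0 ?mulr0 ?(leq_trans cm) // -mXD u0 ?subrr //.
    by rewrite mdegD mdeg1.
  - exact: commutator_linear.
apply: (linear_eqX ul) => [c x y|]; first by rewrite scaler0 addr0.
elim/mnm_indU => [|c k uc]; first by rewrite u0 ?mdeg0.
by rewrite mXD -uU uc mulr0.
Qed.

(* Subtracting suitable f d^[c] with |c| = 0, 1, ..., m from an operator of   *)
(* order <= m makes it vanish on all monomials of degree <= m, hence it is 0  *)
(* by diffop_eq0.                                                             *)
Lemma mop_spanning : spanning (fun x => mop x.1 x.2).
Proof.
pose sp u := exists l, u = lincomb (fun x => mop x.1 x.2) l.
have spD u v : sp u -> sp v -> sp (u + v).
  by move=> [l ->] [l' ->]; exists (l ++ l'); rewrite lincomb_cat.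
have spM (f : A) b : sp (diffop_mult f * mop 0%MM b).
  have [l ->] := mX_span X f; exists [seq (x.1, (x.2, b)) | x <- l].
  apply: diffopP => y; rewrite /lincomb big_map diffop_sumE diffop_mulE /=.
  rewrite mulr_suml; apply: eq_bigr => x _.
  by rewrite -scalerAl [mop x.2 b]mop_mult.
suff H u j : exists v, [/\ sp v, diffop_order j.-1 v &
    forall c, (mdeg c < j)%N -> v (X c) = u (X c)].
  move=> u; have [m um] := diffop_finite_order u.
  have [v [[l vl] vo vu]] := H u m.+1; exists l; rewrite -vl.
  apply/eqP; rewrite -subr_eq0; apply/eqP; apply: (@diffop_eq0 m).
    apply: (diffop_orderD um); exact: diffop_orderZ vo.
  move=> c cm; rewrite diffop_addE -scaleN1r diffop_scaleE vu //.
  by rewrite scaleN1r subrr.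
elim: j => [|j [v [vs vo vu]]].
  by exists 0; split; [exists [::]; rewrite /lincomb big_nil|exact: diffop_order0|].
pose w : diffop A := \sum_(c : 'X_{1..n < j.+1} | mdeg c == j)
   diffop_mult (u (X c) - v (X c)) * mop 0%MM c.
exists (v + w); split.
- apply: (spD) => //; rewrite /w; elim/big_rec: _ => [|c y _ ysp].
    by exists [::]; rewrite /lincomb big_nil.
  exact: spD.
- apply: diffop_orderD; first by apply: diffop_orderW vo; exact: leq_pred.
  rewrite /w; elim/big_rec: _ => [|c y /eqP cj yo]; first exact: diffop_order0.
  apply: diffop_orderD => //=.
  apply: (@diffop_orderM _ _ 0 j (fun x => (u (X c) - v (X c)) * x)).
  + by move=> *; rewrite mulrDr.
  + by move=> r x; rewrite mulrCA subrr.
  + apply: (mop_order _ cj (mopE 0%MM c)); exact: diffop_linear.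
- move=> c cj; rewrite diffop_addE.
  have -> : w (X c) = \sum_(d : 'X_{1..n < j.+1} | mdeg d == j)
     (u (X d) - v (X d)) * ((c == d :> 'X_{1..n})%:R *: X (c - d)%MM).
    rewrite /w diffop_sumE; apply: eq_bigr => d /eqP dj.
    by rewrite diffop_mulE /= mopE add0m mbin_deg // dj -ltnS.
  have [cj'|cj'] := eqVneq (mdeg c) j.
    have cb : (mdeg c < j.+1)%N by rewrite cj'.
    rewrite (bigD1 (BMultinom cb)) //=; last by rewrite cj'.
    rewrite eqxx scale1r submm_id mX0 mulr1 big1 ?addr0 ?subrKC //.
    move=> d /andP[_ dc]; case: eqP => [e|_]; last by rewrite scale0r mulr0.
    by case/eqP: dc; apply: val_inj.
  rewrite big1 ?addr0 ?vu //; first by rewrite ltn_neqAle cj'.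
  move=> d /eqP dj; case: eqP => [e|_]; last by rewrite scale0r mulr0.
  by rewrite e dj eqxx in cj'.
Qed.

(** Induction on |b|: in the value at x^b, terms with b' not below b vanish, terms with b' strictly
    below b have zero coefficient by induction, and the terms with b' = b leave a relation between
    the x^a. *)
Lemma mop_free : free_family (fun x => mop x.1 x.2).
Proof.
move=> l l0; suff H m b : (mdeg b < m)%N -> forall a, lcoef l (a, b) = 0.
  by case=> a b; exact: (H (mdeg b).+1).
elim: m b => // m IH b bm a.
have := congr1 (fun u : diffop A => u (X b)) l0.
have -> : (lincomb (fun x => mop x.1 x.2) l) (X b) =
    \sum_(x <- l) x.1 *: ((mbin b x.2.2)%:R *: X (x.2.1 + (b - x.2.2))%MM).
  rewrite /lincomb diffop_sumE; apply: eq_bigr => x _.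
  by rewrite diffop_scaleE mopE.
rewrite (bigID (fun x => x.2.2 == b)) /=.
rewrite [X in _ + X](lincomb_group (fun x : 'X_{1..n} * 'X_{1..n} =>
  (mbin b x.2)%:R *: X (x.1 + (b - x.2))%MM) l (fun x => x.2 != b)).
rewrite [X in _ + X]big1 ?addr0; last first.
  case=> a' b' /= b'b; have [bb'|/mbin_small ->] := boolP (b' <= b)%MM; last first.
    by rewrite scale0r scaler0.
  suff b'm : (mdeg b' < m)%N by rewrite (IH _ b'm) scale0r.
  rewrite ltnS in bm; apply: leq_trans bm.
  rewrite -(submK bb') mdegD -[ltnLHS]add0n ltn_add2r lt0n mdeg_eq0.
  by apply: contraNneq b'b => e; rewrite -(submK bb') e add0m.
pose l' := [seq (x.1, x.2.1) | x <- l & x.2.2 == b].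
rewrite [LHS](_ : _ = lincomb X l'); last first.
  rewrite /lincomb big_map big_filter; apply: eq_bigr => x /eqP ->.
  by rewrite mbinn scale1r submm_id addm0.
move=> /(mX_free (m := X))/(_ a) <-.
rewrite /lcoef big_map big_filter_cond; apply: eq_bigl => x.
by rewrite -pair_eqE /= andbC.
Qed.

End MonomialOperators.

(** * Multilinear maps and tensor products of operators *)

HB.instance Definition _ (K : comNzRingType) (A : comAlgType K) (u : diffop A) :=
  GRing.isLinear.Build K A A *:%R (diffop_fun u) (diffop_linear u).

Section Multilinear.
Context {K : fieldType} {n : nat} {V_ : 'I_n -> lmodType K}.
Implicit Types v : forall i, V_ i.

Lemma dfwith_id v i : dfwith v (v i) = v.
Proof. by apply: functional_extensionality_dep => j; case: dfwithP. Qed.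

(** The coordinates with index below [m] are still arbitrary; expanding them one at a time in the
    basis reduces to tuples of basis vectors. *)
Lemma multilinear_ind (J : eqType) (b_ : forall i, J -> V_ i)
    (P : (forall i, V_ i) -> Prop) :
  (forall i, spanning (b_ i)) ->
  (forall v i, P (dfwith v (0 : V_ i))) ->
  (forall v i c (x y : V_ i),
     P (dfwith v x) -> P (dfwith v y) -> P (dfwith v (c *: x + y))) ->
  (forall k : 'I_n -> J, P (fun i => b_ i (k i))) ->
  forall v, P v.
Proof.
move=> sp P0 PD Pb v.
suff H m : forall v, (forall i : 'I_n, (m <= i)%N -> exists j, v i = b_ i j) -> P v.
  by apply: (H n) => i; rewrite leqNgt ltn_ord.
elim: m => [|m IH] {}v vb.
  have /all_sig[k kE] i : {j | v i = b_ i j} by apply: cid; exact: vb.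
  by rewrite (_ : v = fun i => b_ i (k i)) //; apply: functional_extensionality_dep.
have [mn|nm] := ltnP m n; last first.
  by apply: IH => i mi; have := ltn_ord i; lia.
pose i0 := Ordinal mn; rewrite -(dfwith_id v i0).
have [l ->] := sp i0 (v i0); rewrite /lincomb.
elim: l => [|x l IHl]; first by rewrite big_nil.
rewrite big_cons; apply: PD => //; apply: IH => i mi.
have [e|ne] := eqVneq i0 i; last first.
  by rewrite dfwith_out //; apply: vb; move: ne; rewrite -val_eqE /=; lia.
by case: i / e {mi}; rewrite dfwith_in; exists x.2.
Qed.

Context {W : lmodType K}.
Implicit Types f g : (forall i, V_ i) -> W.

Lemma multilinear0 f v i : multilinear f -> f (dfwith v (0 : V_ i)) = 0.
Proof.
move=> /(_ v i (-1) 0 0); rewrite scaler0 addr0 scaleN1r addNr; exact.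
Qed.

Lemma multilinearB f v i (x y : V_ i) : multilinear f ->
  f (dfwith v (x - y)) = f (dfwith v x) - f (dfwith v y).
Proof. by move=> /(_ v i (-1) y x); rewrite !scaleN1r addrC => ->; rewrite addrC. Qed.

Lemma multilinear_eq (J : eqType) (b_ : forall i, J -> V_ i) f g :
  (forall i, spanning (b_ i)) -> multilinear f -> multilinear g ->
  (forall k : 'I_n -> J, f (fun i => b_ i (k i)) = g (fun i => b_ i (k i))) ->
  forall v, f v = g v.
Proof.
move=> sp fm gm fg; apply: (multilinear_ind sp) => // [v i|v i c x y fgx fgy].
  by rewrite !multilinear0.
by rewrite fm gm fgx fgy.
Qed.

Lemma multilinear_prod (A : comAlgType K) (f_ : forall i, V_ i -> A) :
  (forall i, linear (f_ i)) -> multilinear (fun v => \prod_i f_ i (v i)).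
Proof.
move=> fl v i c x y; rewrite (bigD1 i) //= [in RHS](bigD1 i) //=.
rewrite [X in _ = _ + X](bigD1 i) //= !dfwith_in fl mulrDl -scalerAl.
by congr (_ *: (_ * _) + _ * _); apply: eq_bigr => j ji;
  rewrite !dfwith_out // eq_sym.
Qed.

Lemma multilinear_comp (W' : lmodType K) (h : {linear W -> W'}) f :
  multilinear f -> multilinear (fun v => h (f v)).
Proof. by move=> fm v i c x y; rewrite fm linearP. Qed.

End Multilinear.

(** * Monomial bases for P_1 and P_n, and tensor products of operators *)

Section Instances.
Context {K : fieldType}.

Definition mnm1d (a : nat) : 'X_{1..1} := [multinom a | i < 1].

Lemma mnm1dE (c : 'X_{1..1}) : mnm1d (c ord0) = c.
Proof. by apply/mnmP => i; rewrite !mnmE; congr (c _); exact/esym/ord1. Qed.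

Lemma poly_mX_span : spanning (fun c : 'X_{1..1} => 'X^(c ord0) : {poly K}).
Proof.
move=> q; exists [seq (q`_i, mnm1d i) | i <- iota 0 (size q)].
rewrite /lincomb big_map -[in LHS](coefK q) poly_def -val_enum_ord big_map.
rewrite big_enum; apply: eq_bigr => i _ /=; by rewrite mnmE.
Qed.

Lemma poly_mX_free : free_family (fun c : 'X_{1..1} => 'X^(c ord0) : {poly K}).
Proof.
move=> l l0 c; have := congr1 (coefp (c ord0)) l0; rewrite /= coef0 => <-.
rewrite coef_sum /lcoef big_mkcond /=; apply: eq_bigr => x _.
rewrite coefZ coefXn; have [->|xc] := eqVneq x.2 c; first by rewrite eqxx mulr1.
case: eqP => [e|_]; last by rewrite mulr0.
by case/eqP: xc; rewrite -(mnm1dE x.2) -(mnm1dE c) e.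
Qed.

Definition poly_mbasis : mbasis {poly K} 1.
Proof.
refine (MBasis _ _ poly_mX_span poly_mX_free) => [|c d].
  by rewrite mnm0E expr0.
by rewrite mnmDE exprD.
Defined.

Context {n : nat}.

Lemma mpoly_mX_span : spanning (fun c : 'X_{1..n} => 'X_[c] : {mpoly K[n]}).
Proof.
move=> q; exists [seq (q@_m, m) | m <- msupp q].
by rewrite /lincomb big_map {1}[q]mpolyE.
Qed.

Lemma mpoly_mX_free : free_family (fun c : 'X_{1..n} => 'X_[c] : {mpoly K[n]}).
Proof.
move=> l l0 c; have := congr1 (mcoeff c) l0; rewrite mcoeff0 => <-.
rewrite /lincomb raddf_sum /lcoef big_mkcond /=; apply: eq_bigr => x _.
by rewrite mcoeffZ mcoeffX; case: eqP; rewrite ?mulr1 ?mulr0.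
Qed.

Definition mpoly_mbasis : mbasis {mpoly K[n]} n.
Proof.
refine (MBasis _ _ mpoly_mX_span mpoly_mX_free) => [|c d].
  by rewrite mpolyX0.
by rewrite mpolyXD.
Defined.

Definition mop1 (x : nat * nat) : DP1 K := mop poly_mbasis (mnm1d x.1) (mnm1d x.2).

Lemma mop1E x (c : nat) : mop1 x 'X^c = ('C(c, x.2))%:R *: 'X^(x.1 + (c - x.2)).
Proof.
have := mopE poly_mbasis (mnm1d x.1) (mnm1d x.2) (mnm1d c).
by rewrite /= mnmDE mnmBE !mnmE /mbin big_ord1 !mnmE.
Qed.

Lemma mop1_spanning : spanning mop1.
Proof.
move=> u; have [l ->] := mop_spanning poly_mbasis u.
exists [seq (x.1, (x.2.1 ord0, x.2.2 ord0)) |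
  x : K * ('X_{1..1} * 'X_{1..1}) <- l].
rewrite /lincomb big_map; apply: eq_bigr => x _.
by rewrite /mop1 !mnm1dE.
Qed.

Lemma mop1_free : free_family mop1.
Proof.
move=> l l0 [a b].
pose l' := [seq (x.1, (mnm1d x.2.1, mnm1d x.2.2)) | x <- l].
have := @mop_free _ _ _ poly_mbasis l' _ (mnm1d a, mnm1d b).
have -> : lcoef l' (mnm1d a, mnm1d b) = lcoef l (a, b).
  rewrite /lcoef big_map; apply: eq_bigl => -[c [a' b']] /=.
  rewrite !xpair_eqE; congr (_ && _).
    by apply/eqP/eqP => [/mnmP/(_ ord0)|->//]; rewrite !mnmE.
  by apply/eqP/eqP => [/mnmP/(_ ord0)|->//]; rewrite !mnmE.
by apply; rewrite /lincomb big_map.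
Qed.

Lemma diffop_eq_mpolyX (u v : DP K n) :
  (forall c : 'X_{1..n}, u 'X_[c] = v 'X_[c]) -> u = v.
Proof. exact: (@diffop_eqX K _ n mpoly_mbasis u v). Qed.

Definition mopn (x : 'X_{1..n} * 'X_{1..n}) : DP K n := mop mpoly_mbasis x.1 x.2.

Lemma is_monomial_opP a b u : is_monomial_op a b u <-> u = mopn (a, b).
Proof.
split=> [H|-> c]; last exact: (mopE mpoly_mbasis).
by apply: diffop_eq_mpolyX => c; rewrite (mopE mpoly_mbasis); exact: H.
Qed.

Lemma horner_alg_linear (i : 'I_n) : linear (horner_alg ('X_i : {mpoly K[n]})).
Proof. by move=> c x y; rewrite linearP /= mulr_algl. Qed.

Lemma horner_algXn (i : 'I_n) (c : nat) :
  horner_alg ('X_i : {mpoly K[n]}) 'X^c = 'X_i ^+ c.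
Proof. by rewrite rmorphXn /= horner_algX. Qed.

Lemma prod_horner_algX (c : 'X_{1..n}) :
  \prod_(i < n) horner_alg ('X_i : {mpoly K[n]}) 'X^(c i) = 'X_[c].
Proof. by rewrite [RHS]mpolyXE_id; apply: eq_bigr => i _; rewrite horner_algXn. Qed.

Lemma is_tensor_op_uniq (d : 'I_n -> DP1 K) u u' :
  is_tensor_op d u -> is_tensor_op d u' -> u = u'.
Proof.
move=> H H'; apply: diffop_eq_mpolyX => c.
by rewrite -prod_horner_algX H H'.
Qed.

Lemma polyXn_spanning : spanning (fun c : nat => 'X^c : {poly K}).
Proof.
move=> q; have [l ->] := poly_mX_span q.
by exists [seq (x.1, x.2 ord0) | x : K * 'X_{1..1} <- l]; rewrite /lincomb big_map.
Qed.

(** Both sides of the defining identity are multilinear in the polynomials q_i, so powers of the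
    variable suffice. *)
Lemma is_tensor_opP (d : 'I_n -> DP1 K) (u : DP K n) :
  (forall c : 'X_{1..n},
     u 'X_[c] = \prod_(i < n) horner_alg 'X_i (d i 'X^(c i))) ->
  is_tensor_op d u.
Proof.
move=> H; apply: (multilinear_eq (V_ := fun _ : 'I_n => {poly K})
  (b_ := fun _ (c : nat) => 'X^c)) => [i|||k].
- exact: polyXn_spanning.
- apply: multilinear_comp.
  apply: (multilinear_prod (V_ := fun _ => {poly K})
    (f_ := fun i q => horner_alg ('X_i : {mpoly K[n]}) q)).
  exact: horner_alg_linear.
- by apply: (multilinear_prod (V_ := fun _ => {poly K})
    (f_ := fun i q => horner_alg ('X_i : {mpoly K[n]}) (d i q))) => i c x y;
    rewrite linearP horner_alg_linear.
- have := H [multinom k i | i < n].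
  rewrite -prod_horner_algX; under eq_bigr do rewrite mnmE.
  by move=> ->; apply: eq_bigr => i _; rewrite mnmE.
Qed.

Lemma mopn_tensor (k : 'I_n -> nat * nat) :
  is_tensor_op (fun i => mop1 (k i))
    (mopn ([multinom (k i).1 | i < n], [multinom (k i).2 | i < n])).
Proof.
apply: is_tensor_opP => c; rewrite [LHS](mopE mpoly_mbasis) /=.
rewrite -prod_horner_algX /mbin natr_prod -scaler_prod.
apply: eq_bigr => i _.
by rewrite mop1E linearZ /= mulr_algl !horner_algXn mnmDE mnmBE !mnmE.
Qed.

Lemma diffop_multilinear (q : 'I_n -> {poly K}) :
  multilinear (V_ := fun _ : 'I_n => DP1 K)
    (fun d => \prod_(i < n) horner_alg ('X_i : {mpoly K[n]}) (d i (q i))).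
Proof.
apply: (multilinear_prod (V_ := fun _ => DP1 K)
  (f_ := fun i d => horner_alg ('X_i : {mpoly K[n]}) (d (q i)))) => i c x y.
by rewrite diffop_addE diffop_scaleE horner_alg_linear.
Qed.

Lemma is_tensor_op_dfwith (d : 'I_n -> DP1 K) i c (x y : DP1 K) u v :
  is_tensor_op (dfwith d (i := i) x) u -> is_tensor_op (dfwith d (i := i) y) v ->
  is_tensor_op (dfwith d (i := i) (c *: x + y)) (c *: u + v).
Proof.
move=> Hu Hv q; rewrite diffop_addE diffop_scaleE Hu Hv.
by have := @diffop_multilinear q d i c x y; rewrite /= => <-.
Qed.

Lemma tensor_op_exists (d : 'I_n -> DP1 K) : exists u, is_tensor_op d u.
Proof.
apply: (multilinear_ind (V_ := fun _ : 'I_n => DP1 K) (b_ := fun _ => mop1)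
    (P := fun d => exists u, is_tensor_op d u))
  => [i|{}d i|{}d i c x y [u Hu] [v Hv]|k].
- exact: mop1_spanning.
- exists 0 => q; have := multilinear0 d i (diffop_multilinear q).
  by rewrite /= => ->.
- by exists (c *: u + v); apply: is_tensor_op_dfwith.
- by exists (mopn ([multinom (k i).1 | i < n], [multinom (k i).2 | i < n]));
    exact: mopn_tensor.
Qed.

Definition tensor_op (d : 'I_n -> DP1 K) : DP K n :=
  projT1 (cid (tensor_op_exists d)).

Lemma tensor_opP d : is_tensor_op d (tensor_op d).
Proof. by rewrite /tensor_op; case: cid. Qed.

Lemma tensor_opE d u : is_tensor_op d u -> u = tensor_op d.
Proof. by move=> /is_tensor_op_uniq; apply; exact: tensor_opP. Qed.

Lemma tensor_op_multilinear :
  multilinear (V_ := fun _ : 'I_n => DP1 K) tensor_op.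
Proof.
move=> d i c x y; symmetry; apply: tensor_opE.
by apply: is_tensor_op_dfwith; exact: tensor_opP.
Qed.

Lemma tensor_opM d e : tensor_op (fun i => d i * e i) = tensor_op d * tensor_op e.
Proof.
symmetry; apply: tensor_opE => q.
by rewrite diffop_mulE (tensor_opP e) (tensor_opP d).
Qed.

Lemma mopnE (x : 'X_{1..n} * 'X_{1..n}) :
  mopn x = tensor_op (fun i => mop1 (x.1 i, x.2 i)).
Proof.
apply: tensor_opE; have := mopn_tensor (fun i => (x.1 i, x.2 i)).
congr (is_tensor_op _ (mopn _)); case: x => a b /=.
by congr (_, _); apply/mnmP => i; rewrite mnmE.
Qed.

Lemma mopn_spanning : spanning mopn.
Proof. exact: mop_spanning. Qed.

Lemma mopn_free : free_family mopn.
Proof. exact: mop_free. Qed.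

End Instances.

(** * Presentations of outer tensor products *)

Section Span.
Context {R : pzRingType} {V : lmodType R}.
Implicit Types (S : set V) (v w : V).

Lemma lspan_gen S v : S v -> lspan S v.
Proof.
move=> Sv; exists [:: (1, v)]; split; last by rewrite big_seq1 scale1r.
by move=> x; rewrite inE => /eqP ->.
Qed.

Lemma lspanP S v : reflect (lspan S v) (v \in spanpred S).
Proof. exact: asboolP. Qed.

Lemma lspan0 S : lspan S 0.
Proof. exact/lspanP/rpred0. Qed.

Lemma lspanD S v w : lspan S v -> lspan S w -> lspan S (v + w).
Proof. by move=> /lspanP Sv /lspanP Sw; apply/lspanP/rpredD. Qed.

Lemma lspanZ S a v : lspan S v -> lspan S (a *: v).
Proof. by move=> /lspanP Sv; apply/lspanP/rpredZ. Qed.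

Lemma lspanB S v w : lspan S v -> lspan S w -> lspan S (v - w).
Proof. by move=> /lspanP Sv /lspanP Sw; apply/lspanP/rpredB. Qed.

Lemma lspan_ind S (P : V -> Prop) :
  P 0 -> (forall v w, P v -> P w -> P (v + w)) ->
  (forall a v, S v -> P (a *: v)) -> forall v, lspan S v -> P v.
Proof.
move=> P0 PD PS _ [l [lS ->]]; rewrite big_seq; elim/big_ind: _ => // x /lS[_].
exact: PS.
Qed.

Lemma lspan_sub S S' : (forall v, S v -> lspan S' v) ->
  forall v, lspan S v -> lspan S' v.
Proof.
move=> SS'; apply: lspan_ind; [exact: lspan0|exact: lspanD|].
by move=> a v /SS'; exact: lspanZ.
Qed.

Lemma quotmod_pi_eq0 S v : quotmod_pi S v = 0 <-> lspan S v.
Proof.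
have <- : quotmod_pi S 0 = 0.
  by apply: (addrI (quotmod_pi S 0)); rewrite -quotmod_piD !addr0.
by rewrite quotmod_piP subr0.
Qed.

Lemma quotmod_piB S v w :
  quotmod_pi S (v - w) = quotmod_pi S v - quotmod_pi S w.
Proof. by apply: (addIr (quotmod_pi S w)); rewrite -quotmod_piD !subrK. Qed.

End Span.

(** [N] is [A] modulo the left ideal generated by [S], with [e] the class of 1; in [A^o] the span is
    that left ideal. *)
Definition presents (A : nzRingType) (N : lmodType A) (e : N) (S : set A) :=
  (forall v, exists a, v = a *: e) /\
  (forall a, a *: e = 0 <-> lspan (S : set A^o) a).

Section Presents.
Context {K : fieldType} {A : algType K}.
Implicit Types (N : lmodType A) (S : set A) (a b : A).

Lemma quotmod_pi1 S a :
  quotmod_pi (S : set A^o) a = a *: quotmod_pi (S : set A^o) 1.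
Proof. by rewrite -[a in LHS]mulr1; exact: (@quotmod_piZ A A^o S a 1). Qed.

Lemma quotmod_presents S : presents (quotmod_pi (S : set A^o) 1) S.
Proof.
split=> [v|a].
  by exists (quotmod_repr v); rewrite -quotmod_pi1 quotmod_piK.
rewrite -quotmod_pi1; exact: quotmod_pi_eq0.
Qed.

Lemma restr_scaleE N (c : K) (v : restr N) : c *: v = c%:A *: (v : N).
Proof. by []. Qed.

Lemma restr_scalerA N (c : K) a (e : N) :
  (c *: a) *: e = c *: (a *: e : restr N).
Proof. by rewrite restr_scaleE scalerA mulr_algl. Qed.

Lemma restr_act_linear N (e : N) : linear (fun a => (a *: e : restr N)).
Proof. by move=> c a b; rewrite scalerDl restr_scaleE scalerA mulr_algl. Qed.

Lemma presents_lift N (e : N) S (U : lmodType K) (f : {linear A -> U}) :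
  presents e S -> (forall a, lspan (S : set A^o) a -> f a = 0) ->
  exists g : {linear restr N -> U}, forall a, g (a *: e) = f a.
Proof.
move=> [gen ker] fS.
pose rep v := projT1 (cid (gen v)).
have repE v : v = rep v *: e by rewrite /rep; case: cid.
have wd a b : a *: e = b *: e -> f a = f b.
  move=> ab; apply/eqP; rewrite -subr_eq0 -linearB fS //.
  by apply/ker; rewrite scalerBl ab subrr.
have glin : linear (fun v : restr N => f (rep v)).
  move=> c u v; rewrite -linearP; apply: wd; rewrite -repE.
  by rewrite restr_act_linear -!repE.
by exists (linear_of glin) => a; apply: wd; rewrite -repE.
Qed.

End Presents.

(** * Outer tensor products of cyclic modules *)

Section OuterTensor.
Context {K : fieldType} {n : nat} (gens : 'I_n -> seq (nat * nat)).
Local Notation D1 := (fun _ : 'I_n => DP1 K).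
Implicit Types (d : 'I_n -> DP1 K) (u : DP K n).

(* The i-th factor will be D(P_1) modulo the left ideal J1 i generated by     *)
(* gens1 i, and their outer tensor product D(P_n) modulo J.                   *)
Definition gens1 i : set (DP1 K) := [set mop1 g | g in [set` gens i]]%classic.
Definition gensn : set (DP K n) := [set u | exists i g, g \in gens i /\
  u = tensor_op (dfwith (T := D1) (fun=> 1) (i := i) (mop1 g))]%classic.

Local Notation J1 i := (lspan (gens1 i : set (DP1 K)^o)).
Local Notation J := (lspan (gensn : set (DP K n)^o)).

Lemma J1M i a b : J1 i b -> J1 i (a * b).
Proof. exact: (lspanZ (V := (DP1 K)^o)). Qed.

(** An operator a g in slot i splits as (d with a in slot i) times (1 with g in slot i), and the
    second factor is a generator of [J]. *)
Lemma tensor_op_J d i x : J1 i x -> J (tensor_op (dfwith (T := D1) d (i := i) x)).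
Proof.
move: x; apply: lspan_ind => [|x y Jx Jy|a _ [g gi <-]].
- rewrite (multilinear0 (V_ := D1) d i tensor_op_multilinear); exact: lspan0.
- have := @tensor_op_multilinear K n d i 1 x y; rewrite !scale1r => ->.
  exact: lspanD.
- rewrite (_ : dfwith _ _ = fun j => dfwith (T := D1) d (i := i) a j *
    dfwith (T := D1) (fun=> 1) (i := i) (mop1 g) j); last first.
    apply/funext => j; have [<-|ij] := eqVneq i j; first by rewrite !dfwith_in.
    by rewrite !dfwith_out ?mulr1.
  rewrite tensor_opM; apply: (lspanZ (V := (DP K n)^o)); apply: lspan_gen.
  by exists i, g.
Qed.

Lemma tensor_op_congr d d' : (forall i, J1 i (d i - d' i)) ->
  J (tensor_op d - tensor_op d').
Proof.
suff H m : forall d d', (forall i : 'I_n, (m <= i)%N -> d i = d' i) ->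
    (forall i, J1 i (d i - d' i)) -> J (tensor_op d - tensor_op d').
  by apply: (H n) => i; rewrite leqNgt ltn_ord.
elim: m => [|m IH] {}d {}d' dd' Jd.
  rewrite (_ : d = d') ?subrr; first exact: lspan0.
  by apply/funext => i; exact: dd'.
have [mn|nm] := ltnP m n; last first.
  by apply: IH => // i mi; have := ltn_ord i; lia.
pose i0 := Ordinal mn; pose d'' := dfwith (T := D1) d (i := i0) (d' i0).
rewrite -(subrKA (tensor_op d'')); apply: lspanD.
  rewrite -[in X in X - _](dfwith_id (V_ := D1) d i0) /d''.
  rewrite -(multilinearB (V_ := D1)); last exact: tensor_op_multilinear.
  exact: tensor_op_J.
apply: IH => i; rewrite /d''.
  move=> mi; have [<-|ne] := eqVneq i0 i; first by rewrite dfwith_in.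
  by rewrite dfwith_out //; apply: dd'; move: ne; rewrite -val_eqE /=; lia.
have [<-|ne] := eqVneq i0 i; last by rewrite dfwith_out.
by rewrite dfwith_in subrr; exact: lspan0.
Qed.

(** The basis [mopn] consists of pure tensors of the bases [mop1], so [f] prescribes values on it.
    Left multiples of a generator of [J] expand into pure tensors with a slot in [J1], where [f]
    vanishes. *)
Lemma tensor_op_lift (U : lmodType K) (f : ('I_n -> DP1 K) -> U) :
  multilinear (V_ := D1) f -> (forall d i, J1 i (d i) -> f d = 0) ->
  exists g : {linear DP K n -> U},
    (forall d, g (tensor_op d) = f d) /\ forall u, J u -> g u = 0.
Proof.
move=> fm fJ.
have [g gE] := linear_extension
  (fun x : 'X_{1..n} * 'X_{1..n} => f (fun i => mop1 (x.1 i, x.2 i)))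
  (mopn_spanning (K := K) (n := n))
  (@mopn_free K n).
have gT d : g (tensor_op d) = f d.
  apply: (multilinear_eq (V_ := D1) (b_ := fun _ => mop1)
    (f := fun d => g (tensor_op d))) => // [i||k].
  - exact: mop1_spanning.
  - apply: multilinear_comp; exact: tensor_op_multilinear.
  - rewrite -(tensor_opE (mopn_tensor k)) gE; congr f; apply/funext => i.
    by rewrite !mnmE -surjective_pairing.
exists g; split=> // u; move: u.
apply: (lspan_ind (P := fun u : (DP K n)^o => g u = 0)) 
  => [|u v gu gv|a _ [i [h [hi ->]]]].
- exact: linear0.
- by rewrite linearD gu gv addr0.
- have [l ->] := mopn_spanning a.
  rewrite /lincomb -[_ *: _]/(_ * _) mulr_suml linear_sum big1 // => x _.
  rewrite -scalerAl linearZ /= mopnE -tensor_opM gT (fJ _ i) ?scaler0 //.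
  by rewrite dfwith_in; apply/J1M/lspan_gen; exists h.
Qed.

Context {N_ : 'I_n -> lmodType (DP1 K)} (e_ : forall i, N_ i).
Hypothesis eP : forall i, presents (e_ i) (gens1 i).
Local Notation VN := (fun i => restr (N_ i)).

Definition std_tensor : lmodType (DP K n) := quotmod (gensn : set (DP K n)^o).

Let rep i v := projT1 (cid ((eP i).1 v)).
Let repE i v : v = rep v *: e_ i. Proof. by rewrite /rep; case: cid. Qed.
Let pi u : std_tensor := quotmod_pi (gensn : set (DP K n)^o) u.

Lemma pi_linear : linear (fun u => pi u : restr std_tensor).
Proof.
have piE u : pi u = u *: pi 1 by exact: quotmod_pi1.
by move=> c a b; rewrite (piE (_ + _)) (piE a) (piE b) restr_act_linear.
Qed.

Definition std_tens (v : forall i, restr (N_ i)) : restr std_tensor :=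
  pi (tensor_op (fun i => rep (v i))).

(** The chosen representatives do not matter: changing slots modulo [J1] changes the tensor modulo
    [J]. *)
Lemma std_tensE d : std_tens (fun i => d i *: e_ i) = pi (tensor_op d).
Proof.
apply/quotmod_piP/tensor_op_congr => i; apply/(eP i).2.
by rewrite scalerBl -repE subrr.
Qed.

Lemma dfwith_scale d i (x : DP1 K) :
  (fun j => dfwith (T := D1) d (i := i) x j *: e_ j) =
  dfwith (T := VN) (fun j => d j *: e_ j) (i := i) (x *: e_ i).
Proof.
apply: functional_extensionality_dep => j.
have [<-|ij] := eqVneq i j; first by rewrite !dfwith_in.
by rewrite !dfwith_out.
Qed.

Lemma std_tens_multilinear : multilinear (V_ := VN) std_tens.
Proof.
move=> v i c x y.
rewrite (_ : v = fun j => rep (v j) *: e_ j); last first.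
  by apply: functional_extensionality_dep => j; rewrite -repE.
rewrite [x in LHS]repE [y in LHS]repE [x in RHS]repE [y in RHS]repE.
rewrite -(restr_act_linear (e_ i)).
rewrite -!(dfwith_scale (fun j => rep (v j))) !std_tensE.
rewrite tensor_op_multilinear; exact: pi_linear.
Qed.

Lemma multilinear_act (U : lmodType K) (f : (forall i, restr (N_ i)) -> U) :
  multilinear (V_ := VN) f ->
  multilinear (V_ := D1) (fun d => f (fun i => d i *: e_ i)).
Proof.
by move=> fm d i c x y; rewrite !dfwith_scale restr_act_linear fm.
Qed.

(** A multilinear map on the modules is pulled back to operators along d_i -> d_i e_i, lifted to
    D(P_n), and descends since it kills [J]. Uniqueness holds because the basis operators are pure
    tensors. *)
Lemma std_is_outer_tensor : is_outer_tensor N_ std_tensor std_tens.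
Proof.
have piE u : pi u = u *: pi 1 by exact: quotmod_pi1.
have piP : presents (pi 1) gensn by exact: quotmod_presents.
split; first split.
- exact: std_tens_multilinear.
- move=> U f fm.
  have [||g [gT gJ]] := @tensor_op_lift U (fun d => f (fun i => d i *: e_ i)).
  + exact: multilinear_act.
  + move=> d i /(eP i).2 di0.
    rewrite -(dfwith_id (V_ := D1) d i) dfwith_scale di0.
    exact: (multilinear0 (V_ := VN)).
  have [h hE] := presents_lift piP gJ.
  have htens v : h (std_tens v) = f v.
    rewrite /std_tens piE hE gT; congr f.
    by apply: functional_extensionality_dep => i; rewrite -repE.
  exists h; split=> // h' h'E m; have [u ->] := piP.1 m.
  have hl (k : {linear restr std_tensor -> U}) : linear (fun u => k (u *: pi 1)).
    by move=> c a b; rewrite restr_act_linear linearP.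
  have := spanning_eq (f := linear_of (hl h')) (g := linear_of (hl h))
    (mopn_spanning (K := K) (n := n)); apply => x /=.
  by rewrite mopnE -piE -std_tensE htens h'E.
- move=> d u /tensor_opE -> v.
  rewrite /std_tens piE scalerA -piE -tensor_opM -std_tensE; congr std_tens.
  by apply: functional_extensionality_dep => i; rewrite -scalerA -repE.
Qed.

(* The relations in M are detected by the map to std_tensor given by the      *)
(* universal property.                                                        *)
Lemma outer_tensor_presents (M : lmodType (DP K n)) t :
  is_outer_tensor N_ M t -> presents (t e_ : M) gensn.
Proof.
move=> [[tm tu] tact].
have tE d : t (fun i => d i *: e_ i) = tensor_op d *: (t e_ : M).
  by rewrite (tact _ _ (tensor_opP d)).
split=> [m|u].
  (* Pure tensors span: the projection modulo their span and the zero map agree on them, so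
     uniqueness in the universal property makes the projection zero. *)
  pose S : set (restr M) := [set t v | v in setT]%classic.
  have pil : linear (quotmod_pi S).
    by move=> c x y; rewrite quotmod_piD quotmod_piZ.
  have z_multi : multilinear (V_ := VN) (fun=> 0 : quotmod S).
    by move=> v i c x y; rewrite scaler0 addr0.
  have [g [_ g_uniq]] := tu _ _ z_multi.
  have zl : linear (fun _ : restr M => 0 : quotmod S).
    by move=> c x y; rewrite scaler0 addr0.
  have pi0 : quotmod_pi S m = 0.
    rewrite -[LHS]/(linear_of pil m) (g_uniq (linear_of pil)) => [|v] /=.
      by rewrite -(g_uniq (linear_of zl)).
    by apply/quotmod_pi_eq0/lspan_gen; exists v.
  move/quotmod_pi_eq0: pi0; move: m.
  apply: (lspan_ind (P := fun m : restr M => exists u, m = u *: (t e_ : M)))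
    => [|m m' [u ->] [u' ->]|c _ [v _ <-]].
  - by exists 0; rewrite scale0r.
  - by exists (u + u'); rewrite scalerDl.
  - exists (c%:A * tensor_op (fun i => rep (v i))).
    rewrite -scalerA -tE restr_scaleE; congr (_ *: t _).
    by apply: functional_extensionality_dep => i; rewrite -repE.
have sp := mopn_spanning (K := K) (n := n).
split=> [u0|]; last first.
  move: u; apply: (lspan_ind (P := fun u : (DP K n)^o => u *: (t e_ : M) = 0))
    => [|u v u0 v0|u _ [i [h [hi ->]]]].
  - by rewrite scale0r.
  - by rewrite scalerDl u0 v0 addr0.
  - transitivity (u *: (tensor_op (dfwith (T := D1) (fun=> 1) (i := i) (mop1 h))
      *: (t e_ : M))); first by rewrite scalerA.
    rewrite -tE dfwith_scale.
    have /(eP i).2 -> : J1 i (mop1 h) by apply: lspan_gen; exists h.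
    by rewrite (multilinear0 (V_ := VN)) ?scaler0.
have [g [gE _]] := tu _ _ std_tens_multilinear.
have gl : linear (fun u => g (u *: (t e_ : M))).
  by move=> c a b; rewrite restr_act_linear linearP.
have gact : g (u *: (t e_ : M)) = pi u.
  have := spanning_eq (f := linear_of gl) (g := linear_of pi_linear) sp.
  by apply => x /=; rewrite mopnE -tE gE std_tensE.
apply/(quotmod_presents (gensn : set (DP K n))).2.
by rewrite -quotmod_pi1 -/(pi u) -gact u0 linear0.
Qed.

End OuterTensor.

(** * The module M(k) *)

Lemma presents_eq (A : nzRingType) (N : lmodType A) (e : N) (S S' : set A) :
  (forall a, S a -> lspan (S' : set A^o) a) ->
  (forall a, S' a -> lspan (S : set A^o) a) -> presents e S -> presents e S'.
Proof.
by move=> SS' S'S [gen ker]; split=> // a; rewrite ker; split; exact: lspan_sub.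
Qed.

Section BaseChange.
Context {K : fieldType} {p : nat} (hp : p \in [pchar K]) (k : nat).
Local Notation T := (Tk hp k).
Local Notation N := (Tk_quotient hp k).
Local Notation piN := (quotmod_pi (@Lambda_plus K p hp k : set T^o)).

Definition Tk_gens : set (DP1 K) :=
  [set Tk_val u | u in @Lambda_plus K p hp k]%classic.
Local Notation Q := (quotmod (Tk_gens : set (DP1 K)^o)).
Local Notation piQ := (quotmod_pi (Tk_gens : set (DP1 K)^o)).

Lemma Tk_gens_lspan (y : T) :
  lspan (@Lambda_plus K p hp k : set T^o) y ->
  lspan (Tk_gens : set (DP1 K)^o) (Tk_val y).
Proof.
move: y; apply: (lspan_ind (V := T^o)
  (P := fun y : T => lspan (Tk_gens : set (DP1 K)^o) (Tk_val y))).
- exact: lspan0.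
- by move=> x y; exact: lspanD.
- move=> a y Ly; apply: (lspanZ (V := (DP1 K)^o) (Tk_val a)).
  by apply: lspan_gen; exists y.
Qed.

Definition Mk_tens (a : DP1 K) (x : N) : Q :=
  piQ (a * Tk_val (quotmod_repr (x : quotmod (@Lambda_plus K p hp k : set T^o)))).

Lemma Mk_tensE a (y : T) : Mk_tens a (piN y) = piQ (a * Tk_val y).
Proof.
apply/quotmod_piP; rewrite -mulrBr; apply: (lspanZ (V := (DP1 K)^o)).
apply: (Tk_gens_lspan (y := _ - y)); apply/quotmod_piP.
by rewrite quotmod_piK.
Qed.

Lemma piN_surj (x : N) : exists y, x = piN y.
Proof. by exists (quotmod_repr x); rewrite quotmod_piK. Qed.

Lemma piN1 (y : T) : piN y = y *: (piN 1 : N).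
Proof. by rewrite -[y in LHS]mulr1; exact: (@quotmod_piZ T T^o _ y 1). Qed.

Lemma Mk_tens_balanced : balanced (@Tk_val K p hp k) Mk_tens.
Proof.
split=> [a b x|a x y|a c x].
- by rewrite /Mk_tens mulrDl quotmod_piD.
- have [[x' ->] [y' ->]] := (piN_surj x, piN_surj y).
  by rewrite -quotmod_piD !Mk_tensE mulrDr quotmod_piD.
- have [x' ->] := piN_surj x.
  rewrite -[c *: _]/(quotmod_scale c (piN x')) -quotmod_piZ !Mk_tensE.
  by rewrite -mulrA.
Qed.

Lemma Mk_tens_act a b x : Mk_tens (a * b) x = a *: Mk_tens b x.
Proof.
by rewrite /Mk_tens -mulrA; exact: (@quotmod_piZ _ (DP1 K)^o Tk_gens a).
Qed.

(** A balanced map satisfies f(a, y) = f(a y, 1), so it is determined by a -> f(a, 1), which kills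
    the left ideal generated by [Tk_gens]. *)
Lemma Mk_tens_base_change : is_base_change (@Tk_val K p hp k) Mk_tens.
Proof.
split; [exact: Mk_tens_balanced|exact: Mk_tens_act|].
move=> G f [fDl fDr fB].
have f0l x : f 0 x = 0 by apply: (addrI (f 0 x)); rewrite -fDl !addr0.
have f0r a : f a 0 = 0 by apply: (addrI (f a 0)); rewrite -fDr !addr0.
have fNl a x : f (- a) x = - f a x.
  by apply: (addIr (f a x)); rewrite -fDl !addNr f0l.
have fS a : lspan (Tk_gens : set (DP1 K)^o) a -> f a (piN 1) = 0.
  move: a; apply: (lspan_ind (P := fun a : (DP1 K)^o => f a (piN 1) = 0)) => //.
    by move=> a b fa fb; rewrite fDl fa fb addr0.
  move=> a _ [y Ly <-]; rewrite -[_ *: _]/(a * _) fB -piN1.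
  by have /quotmod_pi_eq0 -> := lspan_gen (V := T^o) Ly.
have wd a b : piQ a = piQ b -> f a (piN 1) = f b (piN 1).
  by move=> /quotmod_piP/fS; rewrite fDl fNl => /eqP; rewrite subr_eq0 => /eqP.
have gadd (x y : Q) : f (quotmod_repr (x - y)) (piN 1) =
    f (quotmod_repr x) (piN 1) - f (quotmod_repr y) (piN 1).
  rewrite -fNl -fDl; apply: wd.
  by rewrite (quotmod_piB (V := (DP1 K)^o)) !quotmod_piK.
exists (additive_of gadd); split=> [a x|h hE z] /=.
  have [y ->] := piN_surj x; rewrite [RHS](_ : _ = f (a * Tk_val y) (piN 1)).
    by apply: wd; rewrite quotmod_piK Mk_tensE.
  by rewrite fB -piN1.
rewrite -[z in LHS]quotmod_piK -hE; congr (h _).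
by rewrite Mk_tensE mulr1.
Qed.

Lemma is_Mk_exists : is_Mk hp k Q.
Proof. by exists Mk_tens; exact: Mk_tens_base_change. Qed.

(** M(k) is D(P_1) modulo the left ideal generated by the image of Lambda_+, with generator 1 (x) 1.
    The relations are detected by mapping to the model [Q] through [Mk_tens]. *)
Lemma is_Mk_presents (M : lmodType (DP1 K)) : is_Mk hp k M ->
  exists e : M, presents e Tk_gens.
Proof.
move=> [t [[tDl tDr tB] tact tuniv]]; exists (t 1 (piN 1)).
have tE a y : t a (piN y) = (a * Tk_val y) *: t 1 (piN 1).
  by rewrite piN1 -tB -[a * _ in LHS]mulr1 tact.
have t0r a : t a 0 = 0 by apply: (addrI (t a 0)); rewrite -tDr !addr0.
split=> [m|a].
  (* Modulo the submodule generated by 1 (x) 1 the projection and the zero map agree on all tensors,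
     so they coincide. *)
  pose S : set M := [set t 1 (piN 1)]%classic.
  have zbal : balanced (@Tk_val K p hp k)
      (fun (_ : DP1 K) (_ : N) => 0 : quotmod S).
    by split=> *; rewrite ?addr0.
  have [g [_ g_uniq]] := tuniv _ _ zbal.
  have zB : forall x y : M, 0 = 0 - 0 :> quotmod S by move=> *; rewrite subr0.
  have : quotmod_pi S m = 0.
    rewrite -[LHS]/(additive_of (@quotmod_piB _ _ S) m).
    rewrite (g_uniq (additive_of (@quotmod_piB _ _ S))) => [|b x] /=.
      by rewrite -(g_uniq (additive_of zB)).
    apply/quotmod_pi_eq0; have [y ->] := piN_surj x; rewrite tE.
    by apply/lspanZ/lspan_gen.
  move/quotmod_pi_eq0; move: m; apply: lspan_ind => [|x y [b ->] [c ->]|b _ ->].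
  - by exists 0; rewrite scale0r.
  - by exists (b + c); rewrite scalerDl.
  - by exists b.
have [g [gE _]] := tuniv _ _ Mk_tens_balanced.
split=> [a0|].
  apply/(quotmod_pi_eq0 (Tk_gens : set (DP1 K)^o)).
  by have := gE a (piN 1); rewrite Mk_tensE tE !mulr1 a0 raddf0.
move: a; apply: (lspan_ind (P := fun a : (DP1 K)^o => a *: t 1 (piN 1) = 0)).
- by rewrite scale0r.
- by move=> a b a0 b0; rewrite scalerDl a0 b0 addr0.
- move=> a _ [y Ly <-]; rewrite -[X in X *: t _ _]/(a * Tk_val y) -tE.
  by have /quotmod_pi_eq0 -> := lspan_gen (V := T^o) Ly.
Qed.

End BaseChange.

(** * Normal forms in the one-variable factors *)

Section FactorData.
Context {K : fieldType} {p : nat} (hp : p \in [pchar K]) (k s : nat).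
Local Notation q := (p ^ k)%N.

Definition fgens (i : nat) : seq (nat * nat) :=
  if i == 0%N then [seq (0%N, j) | j <- iota 1 q.-1]
  else if (i <= s)%N then [::] else [:: (1%N, 0%N)].

Definition fgood (i : nat) (x : nat * nat) : bool :=
  if i == 0%N then (q %| x.2)%N else (i <= s)%N || (x.1 == 0%N).

(* If fred i x = (c, y), then mop1 x = c *: mop1 y modulo the left ideal of   *)
(* the i-th factor, and the mop1 y with fgood i y form a basis of the         *)
(* quotient. The last case is the relation x^a d^[b] = (-1)^a d^[b - a] in    *)
(* Lambda_{-1}.                                                               *)
Definition fred (i : nat) (x : nat * nat) : K * (nat * nat) :=
  if i == 0%N then if (q %| x.2)%N then (1, x) else (0, (0%N, 0%N))
  else if (i <= s)%N then (1, x)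
  else if (x.1 <= x.2)%N then ((-1) ^+ x.1, (0%N, (x.2 - x.1)%N))
  else (0, (0%N, 0%N)).

Lemma fred_good i x : fgood i (fred i x).2.
Proof.
rewrite /fgood /fred; case: eqP => _; first by case: ifP => //=.
by case: ifP => //= _; case: ifP.
Qed.

Lemma fred_weight i x : ((fred i x).2.1 + (fred i x).2.2 <= x.1 + x.2)%N.
Proof.
by rewrite /fred; do !case: ifP => //= _; rewrite add0n; lia.
Qed.

Lemma fred_id i x : fgood i x -> fred i x = (1, x).
Proof.
rewrite /fgood /fred; case: eqP => _; first by move=> ->.
case: ifP => //= _ /eqP x10; rewrite x10 leq0n expr0 subn0.
by rewrite -x10 -surjective_pairing.
Qed.

Lemma mop1_mulD (x : nat * nat) j :
  mop1 x * mop1 (0%N, j) = 'C(x.2 + j, x.2)%:R *: mop1 (x.1, x.2 + j)%N :> DP1 K.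
Proof.
have := mop_mulD (@poly_mbasis K) (mnm1d x.1) (mnm1d x.2) (mnm1d j).
have -> : (mnm1d x.2 + mnm1d j)%MM = mnm1d (x.2 + j).
  by apply/mnmP => i; rewrite mnmDE !mnmE.
by rewrite /mbin big_ord1 !mnmE /mop1 /= => <-.
Qed.

Lemma mop1_mulX (x : nat * nat) :
  mop1 x * mop1 (1%N, 0%N) = mop1 (x.1.+1, x.2) +
    (if (0 < x.2)%N then mop1 (x.1, x.2.-1) else 0) :> DP1 K.
Proof.
have := mop_mulX (@poly_mbasis K) (mnm1d x.1) (mnm1d x.2) ord0.
have -> : U_(ord0)%MM = mnm1d 1 by apply/mnmP => -[[|//] lt0]; rewrite !mnmE.
have -> : (mnm1d x.1 + mnm1d 1)%MM = mnm1d x.1.+1.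
  by apply/mnmP => i; rewrite mnmDE !mnmE addn1.
have -> : (mnm1d x.2 - mnm1d 1)%MM = mnm1d x.2.-1.
  by apply/mnmP => i; rewrite mnmBE !mnmE subn1.
have -> : 0%MM = mnm1d 0 by apply/mnmP => i; rewrite !mnmE.
by rewrite mnmE.
Qed.

Lemma nderivn_mop1 j (g : {poly K}) : g^`N(j) = mop1 (0%N, j) g.
Proof.
have nl : linear (nderivn (R := K) j) by move=> a x y; rewrite linearP.
apply: (spanning_eq (f := linear_of nl)
  (g := linear_of (diffop_linear (mop1 (0%N, j)))) (@polyXn_spanning K)) => b /=.
by rewrite mop1E nderivnXn add0n scaler_nat.
Qed.

Lemma mult_mop1 : diffop_mult 'X = mop1 (1%N, 0%N) :> DP1 K.
Proof.
have := mop_mult0 (@poly_mbasis K) (mnm1d 1); rewrite /= mnmE expr1 => <-.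
by congr mop; apply/mnmP => i; rewrite !mnmE.
Qed.

Lemma q_gt0 : (0 < q)%N.
Proof. by rewrite expn_gt0 prime_gt0 ?(pcharf_prime hp). Qed.

(* (1 + X)^(q m + r) = (1 + X^q)^m (1 + X)^r in characteristic p, with q a    *)
(* power of p.                                                                *)
Lemma bin_pchar_modn m r j : (r < q)%N -> (j < q)%N ->
  'C(q * m + r, j)%:R = 'C(r, j)%:R :> K.
Proof.
have coefE N l : (('X + 1) ^+ N : {poly K})`_l = 'C(N, l)%:R.
  elim: N l => [|N IH] l; first by rewrite expr0 coef1 bin0n.
  rewrite exprS mulrDl mul1r coefD coefXM !IH.
  by case: l => [|l]; rewrite ?add0r ?bin0 //= binS natrD addrC.
move=> rq jq; elim: m => [|m IH]; first by rewrite muln0.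
rewrite -IH -!coefE mulnS -addnA exprD.
have -> : (('X + 1) ^+ q : {poly K}) = 'X^q + 1.
  have hP : p \in [pchar {poly K}] by rewrite pchar_poly.
  rewrite (@exprDn_pchar _ 'X 1 q) ?expr1n //.
  by rewrite pnatX (eq_pnat _ (pcharf_eq hP)) pnat_id ?(pcharf_prime hP).
by rewrite mulrDl mul1r coefD coefXnM jq add0r.
Qed.

(** Thus d^[qm] d^[r] = d^[qm+r]: every divided power of order not divisible by q lies in the
    ideal. *)
Lemma bin_pchar_muln m r : (r < q)%N -> 'C(q * m + r, r)%:R = 1 :> K.
Proof. by move=> rq; rewrite bin_pchar_modn // binn. Qed.

(** Thus d^[b] d^[j] = 0 when q divides b + j, so the generators do not produce any d^[qm]. *)
Lemma bin_pchar_eq0 m j : (0 < j < q)%N -> 'C(q * m, j)%:R = 0 :> K.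
Proof.
move=> /andP[j0 jq]; have := @bin_pchar_modn m 0 j q_gt0 jq.
by rewrite addn0 bin0n eqn0Ngt j0.
Qed.

Context {n : nat}.
Local Notation G := (gens1 (K := K) (fun i : 'I_n => fgens i)).

(** For i = 0, split off the residue r of the exponent modulo q and use d^[qm] d^[r] = d^[qm+r]. For
    Lambda_{-1}, move x to the right with x^a d^[b] x = x^(a+1) d^[b] + x^a d^[b-1] and induct on
    a. *)
Lemma fred_congr (i : 'I_n) x :
  lspan (G i : set (DP1 K)^o) (mop1 x - (fred i x).1 *: mop1 (fred i x).2).
Proof.
have Gmul u g : g \in fgens i -> lspan (G i : set (DP1 K)^o) (u * mop1 g).
  by move=> gi; apply/J1M/lspan_gen; exists g.
have GZ c u : lspan (G i : set (DP1 K)^o) u -> lspan (G i : set (DP1 K)^o) (c *: u).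
  by move=> Gu; rewrite -mulr_algl; exact: J1M.
rewrite /fred; case: eqP => [i0|/eqP i0].
  case: ifP => /= qx; first by rewrite scale1r subrr; exact: lspan0.
  rewrite scale0r subr0; set r := (x.2 %% q)%N.
  have rq : (r < q)%N by rewrite ltn_mod q_gt0.
  have r0 : (0 < r)%N by rewrite lt0n -[r == 0%N]/(q %| x.2)%N qx.
  have xE : x.2 = (q * (x.2 %/ q) + r)%N by rewrite mulnC -divn_eq.
  have := GZ 1 _ (Gmul (mop1 (x.1, q * (x.2 %/ q))%N) (0%N, r) _).
  rewrite scale1r mop1_mulD /= -xE {1}xE.
  have -> : 'C(q * (x.2 %/ q) + r, q * (x.2 %/ q)) = 'C(q * (x.2 %/ q) + r, r).
    by rewrite -bin_sub ?leq_addr // addKn.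
  rewrite bin_pchar_muln // scale1r -surjective_pairing; apply.
  by rewrite /fgens i0 /=; apply: map_f; rewrite mem_iota; have := q_gt0; lia.
case: ifP => [_|iS] /=; first by rewrite scale1r subrr; exact: lspan0.
rewrite [x]surjective_pairing /=; move: x.1 x.2 => a b.
elim: a b => [|a IH] b.
  by rewrite leq0n expr0 scale1r subn0 subrr; exact: lspan0.
have /Gmul H1 : (1%N, 0%N) \in fgens i by rewrite /fgens (negPf i0) iS inE.
have := H1 (mop1 (a, b)); rewrite mop1_mulX /=; case: b => [|b] /= H2.
  by rewrite scale0r subr0; rewrite addr0 in H2.
have := lspanB H2 (IH b); congr lspan.
rewrite ltnS subSS; case: ifP => _ /=.
  by rewrite opprB [X in _ + X]addrC addrA addrK exprS mulN1r scaleNr opprK.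
by rewrite !scale0r !subr0 addrK.
Qed.

(** The reduction is consistent: a map that factors through [fred] vanishes on basis operator times
    generator. For i = 0 the coefficient is a vanishing binomial or the reduction is 0; for
    Lambda_{-1} the two terms cancel by sign. *)
Lemma fred_kill (i : 'I_n) (U : lmodType K) (w : nat * nat -> U)
    (f : {linear DP1 K -> U}) :
  (forall x, f (mop1 x) = (fred i x).1 *: w (fred i x).2) ->
  forall u, lspan (G i : set (DP1 K)^o) u -> f u = 0.
Proof.
move=> fE.
apply: (lspan_ind (P := fun u : (DP1 K)^o => f u = 0)) => [|u v u0 v0|u _ [g gi <-]].
- exact: linear0.
- by rewrite linearD u0 v0 addr0.
have [l ->] := mop1_spanning u.
transitivity (f (lincomb mop1 l * mop1 g)); first by [].
rewrite /lincomb mulr_suml linear_sum big1 // => x _.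
rewrite -scalerAl linearZ /=; apply/eqP; rewrite scaler_eq0; apply/orP; right.
have {}gi : g \in fgens i by [].
apply/eqP; move: x.2 gi => {}x; rewrite /fgens.
case: eqP => [i0 /mapP[j]|/eqP i0].
  rewrite mem_iota => jq ->; rewrite mop1_mulD linearZ /= fE /fred i0 eqxx /=.
  case: ifP => [/dvdnP[m e]|_]; last by rewrite scale0r scaler0.
  rewrite -bin_sub ?leq_addr // addKn e mulnC bin_pchar_eq0 ?scale0r //.
  by have := q_gt0; lia.
case: ifP => // iS; rewrite inE => /eqP ->; rewrite mop1_mulX linearD /= fE.
rewrite /fred (negPf i0) iS /=; case: x => a [|b] /=.
  by rewrite linear0 scale0r addr0.
rewrite fE /fred (negPf i0) iS /= ltnS subSS.
case: ifP => _ /=; last by rewrite !scale0r addr0.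
by rewrite exprS mulN1r scaleNr addNr.
Qed.

Lemma Mks_factor_presents (Mk : lmodType (DP1 K)) (e : Mk) (i : 'I_n) :
  presents e (Tk_gens hp k) ->
  exists e' : Mks_factor Mk s i, presents e' (G i).
Proof.
rewrite /Mks_factor /gens1 /fgens; case: eqP => [_ eP|_ _].
  exists e; apply: presents_eq eP => [_ [u [c uE] <-]|_ [_ /mapP[j jq ->] <-]].
    have -> : Tk_val u = \sum_(1 <= j < q) c j *: mop1 (0%N, j).
      apply/diffopP => g; rewrite uE diffop_sumE; apply: eq_bigr => j _.
      by rewrite diffop_scaleE nderivn_mop1.
    rewrite big_nat; apply: big_ind => [||j jq].
    - exact: lspan0.
    - by move=> x y; exact: lspanD.
    - rewrite -mulr_algl; apply: (lspanZ (V := (DP1 K)^o)); apply: lspan_gen.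
      exists (0%N, j) => //=; apply: map_f; rewrite mem_iota; lia.
  rewrite mem_iota in jq; have jq' : (j < q)%N by lia.
  have uT : mop1 (0%N, j) \in Tkpred hp k.
    apply/asboolP; apply: Tform_ext (Tform1 1 jq') => g.
    by rewrite mul1r nderivn_mop1.
  apply: lspan_gen; exists (MkTk uT) => //=.
  exists (fun i => (i == j)%:R) => g.
  rewrite (bigD1_seq j) ?iota_uniq ?mem_index_iota //=; last by lia.
  rewrite eqxx scale1r nderivn_mop1 big1 ?addr0 // => l /negPf ->.
  by rewrite scale0r.
case: ifP => _.
  exists (1 : (DP1 K)^o); split=> [v|a]; first by exists v; rewrite [RHS]mulr1.
  rewrite -[_ *: _]/(a * 1) mulr1; split=> [->|[l [lS ->]]]; first exact: lspan0.
  by rewrite big_seq big1 // => x /lS[_ [g]].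
exists (quotmod_pi _ 1); apply: presents_eq (quotmod_presents _) => a.
  move=> ->; apply: lspan_gen; exists (1%N, 0%N); first by rewrite /= inE.
  by rewrite mult_mop1.
by move=> [g /=]; rewrite inE => /eqP -> <-; apply: lspan_gen; rewrite /= mult_mop1.
Qed.

End FactorData.

(** * Normal forms in M(k, s) *)

Section MksPresentation.
Context {K : fieldType} {p : nat} (hp : p \in [pchar K]) {n : nat} (k s : nat).
Local Notation fg := (fun i : 'I_n => fgens (p := p) k s i).
Local Notation J := (lspan (gensn (K := K) fg : set (DP K n)^o)).

Lemma Mks_exists : exists M : lmodType (DP K n), is_Mks hp k s M.
Proof.
have [e eP] := is_Mk_presents (is_Mk_exists hp k).
pose e_ (i : 'I_n) := projT1 (cid (Mks_factor_presents s i eP)).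
have e_P i : presents (e_ i) (gens1 fg i) by rewrite /e_; case: cid.
exists (std_tensor fg : lmodType (DP K n)); eexists; first exact: is_Mk_exists.
by exists (std_tens e_P); exact: std_is_outer_tensor.
Qed.

Lemma Mks_presents (M : lmodType (DP K n)) : is_Mks hp k s M ->
  exists e : M, presents e (gensn fg).
Proof.
move=> [Mk /is_Mk_presents [e eP] [t tP]].
pose e_ (i : 'I_n) := projT1 (cid (Mks_factor_presents s i eP)).
have e_P i : presents (e_ i) (gens1 fg i) by rewrite /e_; case: cid.
by exists (t e_); exact: (outer_tensor_presents e_P tP).
Qed.

Implicit Types x y : 'X_{1..n} * 'X_{1..n}.

Definition mgood x : bool := [forall i : 'I_n, fgood (p := p) k s i (x.1 i, x.2 i)].
Definition mweight x : nat := (mdeg x.1 + mdeg x.2)%N.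

Lemma tensor_op_scale (c : 'I_n -> K) (d : 'I_n -> DP1 K) :
  tensor_op (fun i => c i *: d i) = (\prod_i c i) *: tensor_op d.
Proof.
symmetry; apply: tensor_opE => q.
rewrite diffop_scaleE (tensor_opP d) -scaler_prod; apply: eq_bigr => i _.
by rewrite diffop_scaleE linearZ /= mulr_algl.
Qed.

(** Reduction is performed slot by slot. The weight bound is what lets good monomials of weight at
    most i span the whole of F_i e. *)
Lemma mgood_red x : exists (c : K) y,
  [/\ mgood y, (mweight y <= mweight x)%N & J (mopn x - c *: mopn y)].
Proof.
pose r (i : 'I_n) := fred (K := K) (p := p) k s i (x.1 i, x.2 i).
exists (\prod_i (r i).1), ([multinom (r i).2.1 | i < n], [multinom (r i).2.2 | i < n]).
split.
- apply/forallP => i; rewrite !mnmE -surjective_pairing; exact: fred_good.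
- rewrite /mweight !mdegE -!big_split /=; apply: leq_sum => i _; rewrite !mnmE.
  exact: fred_weight.
- rewrite !mopnE.
  have -> : (\prod_i (r i).1) *: tensor_op (fun i => mop1
      ([multinom (r i0).2.1 | i0 < n] i, [multinom (r i0).2.2 | i0 < n] i)) =
      tensor_op (fun i => (r i).1 *: mop1 (r i).2) :> DP K n.
    rewrite tensor_op_scale; congr (_ *: tensor_op _); apply/funext => i.
    by rewrite !mnmE -surjective_pairing.
  apply: tensor_op_congr => i; exact: (fred_congr hp).
Qed.

(** The functional is the product of the one-variable functionals reading off a coefficient of the
    normal form. It gives independence of good monomials modulo [J]. *)
Lemma mgood_dual y : mgood y -> exists f : {linear DP K n -> K^o},
  (forall u, J u -> f u = 0) /\
  forall x, mgood x -> f (mopn x) = (x == y)%:R.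
Proof.
move=> /forallP gy.
have ext (i : 'I_n) : exists f : {linear DP1 K -> K^o}, forall z,
    f (mop1 z) = (fred (K := K) (p := p) k s i z).1 *
      ((fred (K := K) (p := p) k s i z).2 == (y.1 i, y.2 i))%:R.
  exact: (linear_extension (W := K^o) _ (@mop1_spanning K) (@mop1_free K)).
pose f_ (i : 'I_n) := projT1 (cid (ext i)).
have f_E i : forall z, f_ i (mop1 z) = (fred (K := K) (p := p) k s i z).1 *
      ((fred (K := K) (p := p) k s i z).2 == (y.1 i, y.2 i))%:R.
  by rewrite /f_; case: cid.
have [||f [fE fJ]] := tensor_op_lift (gens := fg) (U := K^o)
    (f := fun d => \prod_i f_ i (d i)).
- apply: (multilinear_prod (V_ := fun _ => DP1 K) (A := K^o)
    (f_ := fun i d => f_ i d)) => i c a b; exact: linearP.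
- move=> d i Jd; rewrite (bigD1 i) //=.
  by rewrite (fred_kill hp (w := fun z => (z == (y.1 i, y.2 i))%:R)
    (f := f_ i) (f_E i) Jd) mul0r.
exists f; split=> // x /forallP gx; rewrite mopnE fE.
under eq_bigr => i _ do rewrite f_E fred_id //= mul1r.
have [->|xy] := eqVneq x y; first by rewrite big1 // => i _; rewrite eqxx.
suff [i xyi] : exists i, (x.1 i, x.2 i) != (y.1 i, y.2 i).
  by rewrite (bigD1 i) //= (negPf xyi) mul0r.
apply: contrapT => H; case/eqP: xy.
have {}H i : (x.1 i, x.2 i) = (y.1 i, y.2 i).
  by apply/eqP; apply: contrapT => /negP ne; apply: H; exists i.
rewrite [x]surjective_pairing [y]surjective_pairing.
by congr (_, _); apply/mnmP => i; have [] := H i.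
Qed.

End MksPresentation.

(** * Finite-dimensional subspaces *)

Section FiniteDimension.
Context {K : fieldType} {V : lmodType K}.
Implicit Types (W : set V) (d : nat).

Definition subspace W :=
  W 0 /\ forall c x y, W x -> W y -> W (c *: x + y).

Definition fspan d (b : 'I_d -> V) : set V :=
  [set v | exists c : 'I_d -> K, v = \sum_i c i *: b i]%classic.

Definition ffree d (b : 'I_d -> V) :=
  forall c : 'I_d -> K, \sum_i c i *: b i = 0 -> forall i, c i = 0.

Lemma fspan_subspace d (b : 'I_d -> V) : subspace (fspan b).
Proof.
split; first by exists (fun=> 0); rewrite big1 // => i _; rewrite scale0r.
move=> c _ _ [f ->] [g ->]; exists (fun i => c * f i + g i).
rewrite scaler_sumr -big_split; apply: eq_bigr => i _ /=.
by rewrite scalerDl scalerA.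
Qed.

Lemma subspace_sum W (I : Type) (r : seq I) (P : pred I) (c : I -> K) (v : I -> V) :
  subspace W -> (forall i, P i -> W (v i)) ->
  W (\sum_(i <- r | P i) c i *: v i).
Proof.
move=> [W0 WD] Wv; elim/big_rec: _ => // i x Pi Wx.
exact: WD (Wv i Pi) Wx.
Qed.

(** A vector in the left kernel of the coefficient matrix is a relation between the [b i]; hence the
    matrix has full row rank, at most its number of columns. *)
Lemma ffree_fspan_leq d d' (b : 'I_d -> V) (b' : 'I_d' -> V) :
  ffree b -> (forall i, fspan b' (b i)) -> (d <= d')%N.
Proof.
move=> fb bb'; have /all_sig[c cE] i : {c | b i = \sum_j c j *: b' j}.
  exact: cid (bb' i).
pose C : 'M[K]_(d, d') := \matrix_(i, j) c i j.
suff /eqP <- : row_free C by exact: rank_leq_col.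
rewrite -kermx_eq0; apply/eqP/row_matrixP => i; rewrite row0.
have : row i (kermx C) *m C = 0 by rewrite -row_mul mulmx_ker row0.
move: (row i _) => v vC; apply/rowP => j; rewrite mxE.
apply: (fb (fun j => v 0 j)).
under eq_bigr do rewrite cE scaler_sumr.
rewrite exchange_big big1 // => l _ /=.
under eq_bigr do rewrite scalerA.
rewrite -scaler_suml; have := congr1 (fun A : 'rV_d' => A 0 l) vC.
rewrite !mxE => e; rewrite [X in X *: _](_ : _ = 0) ?scale0r // -[RHS]e.
by apply: eq_bigr => t _; rewrite mxE.
Qed.

Lemma has_dim_uniq W d d' : has_dim W d -> has_dim W d' -> d = d'.
Proof.
move=> [b [fb Wb]] [b' [fb' Wb']]; apply/eqP; rewrite eqn_leq.
rewrite -/(fspan b) -/(fspan b') in Wb Wb'.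
have sub m (a : 'I_m -> V) i : fspan a (a i).
  exists (fun j => (j == i)%:R); rewrite (bigD1 i) //= eqxx scale1r.
  by rewrite big1 ?addr0 // => j /negPf ->; rewrite scale0r.
apply/andP; split.
  by apply: (ffree_fspan_leq (b' := b') fb) => i; rewrite -Wb' Wb; exact: sub.
by apply: (ffree_fspan_leq (b' := b) fb') => i; rewrite -Wb Wb'; exact: sub.
Qed.

Lemma has_dim_sub W W' d' : subspace W -> (W `<=` W')%classic ->
  has_dim W' d' -> exists2 d, (d <= d')%N & has_dim W d.
Proof.
move=> [W0 WD] WW' [b' [fb' Wb']].
pose P d := `[< exists b : 'I_d -> V, ffree b /\ forall i, W (b i) >].
have P0 : exists d, P d.
  exists 0%N; apply/asboolP; exists (fun=> 0).
  by split=> [c _ []|[]].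
have Pd' d : P d -> (d <= d')%N.
  move=> /asboolP[b [fb Wb]]; apply: (ffree_fspan_leq (b' := b') fb) => i.
  by rewrite -/(fspan b') in Wb'; rewrite -Wb'; exact: WW'.
case: (ex_maxnP P0 Pd') => d /asboolP[b [fb bW]] dmax.
exists d; first by apply: Pd'; apply/asboolP; exists b.
exists b; split=> //; apply/seteqP; split=> [w Ww|_ [c ->]]; last first.
  exact: subspace_sum.
(* A vector of [W] outside the span would enlarge the maximal free family; it is put at index
   [ord0], and its coefficient in a relation must vanish because it could otherwise be inverted. *)
apply: contrapT => nw; suff /dmax : P d.+1 by rewrite ltnn.
apply/asboolP; exists (fun i => if unlift ord0 i is Some j then b j else w).
split=> [c|i]; last by case: unliftP.
rewrite big_ord_recl unlift_none.
under eq_bigr do rewrite liftK.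
move=> e; have c0 : c ord0 = 0.
  apply: contrapT => /eqP c0; apply: nw.
  exists (fun i => - (c ord0)^-1 * c (lift ord0 i)).
  under eq_bigr do rewrite -scalerA.
  rewrite -scaler_sumr; move/eqP: e; rewrite addrC addr_eq0 => /eqP ->.
  by rewrite scalerN scaleNr opprK scalerA mulVf // scale1r.
rewrite c0 scale0r add0r in e => i.
by case: (unliftP ord0 i) => [j ->|->//]; exact: (fb (fun j => c (lift ord0 j))).
Qed.

Lemma dimK_eq W d : has_dim W d -> dimK W = d.
Proof.
move=> Wd; rewrite /dimK; case: xgetP => [d' _ Wd'|/(_ d)//].
exact: has_dim_uniq Wd' Wd.
Qed.

End FiniteDimension.

(** * The canonical filtration *)

Section Filtration.
Context {K : fieldType} {n : nat}.
Implicit Types (u v : DP K n) (i j : nat).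
Local Notation F := (canonical_filtration (K := K) (n := n)).

Lemma filtration_mopn i (x : 'X_{1..n} * 'X_{1..n}) :
  (mweight x <= i)%N -> F i (mopn x).
Proof.
move=> xi; apply: lspan_gen; exists x.1, x.2; split=> //.
by apply/is_monomial_opP; rewrite -surjective_pairing.
Qed.

Lemma filtration_ind i (P : DP K n -> Prop) :
  P 0 -> (forall u v, P u -> P v -> P (u + v)) ->
  (forall (c : K) (x : 'X_{1..n} * 'X_{1..n}), (mweight x <= i)%N -> P (c *: mopn x)) ->
  forall u, F i u -> P u.
Proof.
move=> P0 PD PZ; apply: lspan_ind => // c _ [a [b [ab /is_monomial_opP ->]]].
exact: PZ.
Qed.

Lemma filtrationW i j u : (i <= j)%N -> F i u -> F j u.
Proof.
move=> ij; move: u; apply: filtration_ind => [|u v|c x xi].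
- exact: lspan0.
- exact: lspanD.
- by apply/lspanZ/filtration_mopn/(leq_trans xi).
Qed.

Lemma filtration_exhaustive u : exists i, F i u.
Proof.
have [l ->] := mopn_spanning u; elim: l => [|x l [i Fi]].
  by exists 0%N; rewrite /lincomb big_nil; exact: lspan0.
exists (maxn i (mweight x.2)); rewrite /lincomb big_cons; apply: lspanD.
  by apply/lspanZ/filtration_mopn/leq_maxr.
by apply: filtrationW Fi; exact: leq_maxl.
Qed.

Lemma filtration_mulX i u l : F i u -> F i.+1 (u * mopn (U_(l)%MM, 0%MM)).
Proof.
move: u; apply: filtration_ind => [|u v Fu Fv|c [a b] ab].
- by rewrite mul0r; exact: lspan0.
- by rewrite mulrDl; exact: lspanD.
rewrite -scalerAl; apply: lspanZ; rewrite /mopn mop_mulX /=; apply: lspanD.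
  apply: (filtration_mopn (x := (a + U_(l), b)%MM)).
  by move: ab; rewrite /mweight /= mdegD mdeg1; lia.
case: ifP => _; last exact: lspan0.
apply: (filtration_mopn (x := (a, b - U_(l))%MM)).
move: ab; rewrite /mweight /= => ab; apply: leq_trans (leqW ab).
by rewrite leq_add2l !mdegE leq_sum // => j _; rewrite mnmBE leq_subr.
Qed.

(** Right multiplication by x^a is done one variable at a time, each raising the degree by at most
    one; right multiplication by d^[b] then adds at most |b|. *)
Lemma filtrationM i j u v : F i u -> F j v -> F (i + j) (u * v).
Proof.
move=> Fu; move: v; apply: filtration_ind => [|v w Fv Fw|c [a b] ab].
- by rewrite mulr0; exact: lspan0.
- by rewrite mulrDr; exact: lspanD.
rewrite -scalerAr; apply: lspanZ; rewrite /mopn mop_mult /= mulrA.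
rewrite -(mop_mult0 (mpoly_mbasis (K := K) (n := n))).
have Fa : F (i + mdeg a) (u * mopn (a, 0%MM)).
  move: {ab} a; apply: mnm_indU => [|a l Fa].
    rewrite mdeg0 addn0 /mopn /= mop00 mulr1 //.
  rewrite mdegD mdeg1 add1n addnS [(U_(l) + a)%MM]addmC.
  have -> : mopn ((a + U_(l))%MM, 0%MM) =
      mopn (a, 0%MM) * mopn (U_(l)%MM, 0%MM) :> DP K n.
    by rewrite /mopn mop_mulX /= mnm0E addr0.
  by rewrite mulrA; exact: filtration_mulX.
apply: (filtrationW (i := i + mdeg a + mdeg b)); first by rewrite -addnA leq_add2l.
move: (u * _) Fa => {}u {Fu}; move: (_ + _)%N => m.
move: u; apply: filtration_ind => [|u v Fu' Fv|c' [a' b'] ab'].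
- by rewrite mul0r; exact: lspan0.
- by rewrite mulrDl; exact: lspanD.
rewrite -scalerAl; apply: lspanZ; rewrite /mopn mop_mulD /=; apply: lspanZ.
apply: (filtration_mopn (x := (a', b' + b)%MM)).
by move: ab'; rewrite /mweight /= mdegD; lia.
Qed.

Variable M : lmodType (DP K n).

Local Notation FM M0 i := (prodspan (F i) M0).

Lemma prodspan_subspace (M0 : set M) i : subspace (FM M0 i : set (restr M)).
Proof.
split; first by exists [::]; rewrite big_nil.
move=> c _ _ [l [lP ->]] [l' [l'P ->]].
exists ([seq (c *: x.1, x.2) | x : DP K n * M <- l] ++ l'); split.
  move=> x; rewrite mem_cat => /orP[|/l'P //].
  by move=> /mapP[y /lP [Fy My] ->]; split=> //; exact: lspanZ.
rewrite big_cat big_map scaler_sumr; congr (_ + _); apply: eq_bigr => x _ /=.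
by rewrite restr_scaleE scalerA mulr_algl.
Qed.

Lemma prodspan1 (e : M) i m : FM [set e]%classic i m <-> exists2 u, F i u & m = u *: e.
Proof.
split=> [[l [lP ->]]|[u Fu ->]]; last first.
  exists [:: (u, e)]; split; last by rewrite big_seq1.
  by move=> x; rewrite inE => /eqP ->.
rewrite big_seq; elim/big_rec: _ => [|x m' /lP[Fx xe] [u Fu ->]].
  by exists 0; [exact: lspan0|rewrite scale0r].
by exists (x.1 + u); [exact: lspanD|rewrite scalerDl xe].
Qed.

Lemma prodspan_gen (M0 : set M) (e : M) (gen : forall m, exists u, m = u *: e) :
  generating_subspace M0 -> exists a, forall i,
    (FM M0 i `<=` FM [set e] (i + a))%classic.
Proof.
move=> [[d [b [_ M0E]]] _].
have /all_sig2[c cE cF] (j : 'I_d) : {c : DP K n * nat | b j = c.1 *: e & F c.2 c.1}.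
  apply: cid2; have [u uE] := gen (b j); have [m um] := filtration_exhaustive u.
  by exists (u, m).
pose a := (\sum_j (c j).2)%N; exists a => i m [l [lP ->]].
have /= [W0 WD] := prodspan_subspace [set e]%classic (i + a).
rewrite big_seq; elim/big_ind: _ => // [x y Wx Wy|x /lP[Fx Mx]].
  by have := WD 1 _ _ Wx Wy; rewrite scale1r.
rewrite M0E in Mx; have [f ->] := Mx.
apply/prodspan1; exists (x.1 * \sum_j f j *: (c j).1).
  apply: filtrationM => //; apply: (big_ind (F a)).
  - exact: lspan0.
  - exact: lspanD.
  - move=> j _; apply: lspanZ; apply: filtrationW (cF j).
    by rewrite /a (bigD1 j) //= leq_addr.
rewrite -scalerA scaler_suml; congr (_ *: _); apply: eq_bigr => j _.
by rewrite cE restr_scaleE scalerA mulr_algl.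
Qed.

Lemma gen_prodspan (M0 : set M) (e : M) :
  generating_subspace M0 -> exists b, forall i,
    (FM [set e] i `<=` FM M0 (i + b))%classic.
Proof.
move=> [_ M0gen].
have [l [lP eE]] : lspan M0 e by rewrite M0gen.
have [b Fb] : exists b, forall x, x \in l -> F b x.1.
  elim: {lP eE} l => [|x l [b Fb]]; first by exists 0%N.
  have [i Fi] := filtration_exhaustive x.1; exists (maxn i b) => y.
  rewrite inE => /orP[/eqP ->|/Fb]; last by apply: filtrationW; exact: leq_maxr.
  by apply: filtrationW Fi; exact: leq_maxl.
exists b => i m /prodspan1[u Fu ->].
exists [seq (u * x.1, x.2) | x : DP K n * M <- l]; split=> [_ /mapP[x xl ->]|].
  by split; [apply: filtrationM => //; exact: Fb|have [_] := lP _ xl].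
by rewrite eE scaler_sumr big_map; apply: eq_bigr => x _; rewrite scalerA.
Qed.

(** [M0] is finite-dimensional and [e] generates, so M_0 lies in some F_a e; conversely e lies in
    some F_b M_0. Multiplying by F_i gives both inclusions up to shifts. *)
Lemma hilbert_sandwich (e : M) (N : nat -> nat) (M0 : set M) :
  (forall m, exists u, m = u *: e) ->
  (forall i, has_dim (FM [set e]%classic i : set (restr M)) (N i)) ->
  generating_subspace M0 ->
  exists a b, forall i,
    (N i <= hilbert M0 (i + b))%N /\ (hilbert M0 i <= N (i + a))%N.
Proof.
move=> gen dimN M0gen.
have [a Ha] := prodspan_gen gen M0gen; have [b Hb] := gen_prodspan e M0gen.
have dimM0 i : exists2 d, (d <= N (i + a))%N & has_dim (FM M0 i : set (restr M)) d.
  by apply: has_dim_sub (dimN (i + a)%N); [exact: prodspan_subspace|exact: Ha].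
exists a, b => i; split; last first.
  by have [d dN dd] := dimM0 i; rewrite /hilbert (dimK_eq dd).
have [d' _ dd'] := dimM0 (i + b)%N; rewrite /hilbert (dimK_eq dd').
have [d le_dd' dd] := has_dim_sub (prodspan_subspace _ _) (Hb i) dd'.
by rewrite (has_dim_uniq (dimN i) dd).
Qed.

End Filtration.

(** * Counting good monomials *)

Lemma leq_exp_ffact i d : (i ^ d <= (d + i) ^_ d)%N.
Proof.
elim: d => // d IH; rewrite addSn ffactSS expnS leq_mul //.
by rewrite leqW // leq_addl.
Qed.

Lemma ffact_leq_exp m d : (m ^_ d <= m ^ d)%N.
Proof.
elim: d m => // d IH [|m] //; rewrite ffactSS expnS leq_mul //.
by apply: leq_trans (IH m) _; case: d {IH} => // d; rewrite leq_exp2r.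
Qed.

Section Counting.
Variables (p k s n : nat).
Hypotheses (p_gt0 : (0 < p)%N) (sn : (s < n)%N).
Local Notation q := (p ^ k)%N.
Local Notation D := (s.+1 + n)%N.
Local Notation bm i := 'X_{1..n < i.+1}.
Local Notation good := (mgood (p := p) (n := n) k s).

Let q0 : (0 < q)%N. Proof. by rewrite expn_gt0 p_gt0. Qed.
Let o : 'I_n := Ordinal (leq_ltn_trans (leq0n s) sn).

Definition good_set i : {set bm i * bm i} :=
  [set x | good (bmnm x.1, bmnm x.2) && (mweight (bmnm x.1, bmnm x.2) <= i)%N].

(** A good pair has alpha supported in {0,...,s}, so its s+1 first exponents and all of beta form a
    point of N^D. *)
Let enc (a b : 'X_{1..n}) (l : 'I_D) : nat :=
  match fintype.split l with inl j => a (widen_ord sn j) | inr j => b j end.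

Let encl a b j : enc a b (lshift n j) = a (widen_ord sn j).
Proof. by rewrite /enc (unsplitK (inl j)). Qed.

Let encr a b j : enc a b (rshift s.+1 j) = b j.
Proof. by rewrite /enc (unsplitK (inr j)). Qed.

Let enc_sum (a b : 'X_{1..n}) : (forall j : 'I_n, (s < j)%N -> a j = 0%N) ->
  (\sum_l enc a b l = mdeg a + mdeg b)%N.
Proof.
move=> a0; rewrite big_split_ord /= !mdegE; congr (_ + _)%N; last first.
  by apply: eq_bigr => j _; rewrite encr.
under eq_bigr do rewrite encl.
rewrite -(big_ord_narrow (F := fun j => a j) sn).
rewrite [RHS](bigID (fun j : 'I_n => j < s.+1)%N) /=.
rewrite [X in (_ + X)%N]big1 ?addn0 // => j; rewrite ltnS -ltnNge; exact: a0.
Qed.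

Let good0 (x : 'X_{1..n} * 'X_{1..n}) (j : 'I_n) : good x -> (s < j)%N -> x.1 j = 0%N.
Proof.
move=> /forallP/(_ j); rewrite /fgood; case: eqP => [->|_] //.
by case: leqP => //= _ /eqP.
Qed.

Let gooddvd (x : 'X_{1..n} * 'X_{1..n}) : good x -> (q %| x.2 o)%N.
Proof. by move=> /forallP/(_ o). Qed.

Let shift (b : 'X_{1..n}) r : 'X_{1..n} := (b + U_(o) *+ r)%MM.

Let shiftE b r j : shift b r j = (b j + (o == j) * r)%N.
Proof. by rewrite /shift mnmDE mulmnE mnm1E mulnC. Qed.

Let tup m i (x : (bm i * bm i) * 'I_q) : D.-tuple 'I_m.+1 :=
  [tuple inord (enc (bmnm x.1.1) (shift (bmnm x.1.2) x.2) l) | l < D].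

Let tup_sum m (t : D.-tuple 'I_m.+1) :
  (\sum_(j <- t) j = \sum_(l < D) tnth t l)%N.
Proof. exact: big_tuple. Qed.

(* Writing beta_0 = q m + r with r < q turns an exponent in N^D of weight     *)
(* <= i into a good one and a residue, and conversely up to weight i + q.     *)
Lemma card_good_lower i : ('C(D + i, D) <= q * #|good_set i|)%N.
Proof.
(* The binomial counts the D-tuples of sum at most i; [tup] maps good pairs with a residue onto a
   set containing them. *)
rewrite -card_partial_ord_partitions mulnC -[q in leqRHS]card_ord -cardsT.
rewrite -cardsX; apply: leq_trans (leq_imset_card (tup i (i := i)) _).
apply/subset_leq_card/fintype.subsetP => t; rewrite inE tup_sum => ti.
pose f l : nat := tnth t l.
pose a := [multinom (if (j <= s)%N then f (lshift n (inord j)) else 0%N) | j < n].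
pose b := [multinom f (rshift s.+1 j) | j < n].
pose r := (b o %% q)%N; have rq : (r < q)%N by rewrite ltn_mod.
pose b' := (b - U_(o) *+ r)%MM.
have b'E j : b' j = (b j - (o == j) * r)%N.
  by rewrite mnmBE mulmnE mnm1E mulnC.
have bE : shift b' r = b.
  apply/mnmP => j; rewrite shiftE b'E.
  case: eqP => [<-|_]; last by rewrite !mul0n subn0 addn0.
  by rewrite mul1n subnK // leq_mod.
have a0 (j : 'I_n) : (s < j)%N -> a j = 0%N.
  by move=> sj; rewrite mnmE leqNgt sj.
have encE l : enc a b l = f l.
  case: (split_ordP l) => j ->; rewrite ?encl ?encr mnmE //.
  rewrite /= -ltnS ltn_ord; congr (f (lshift _ _)).
  by apply: val_inj; rewrite /= inordK.
have deg : (mdeg a + mdeg b <= i)%N.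
  by rewrite -enc_sum //; under eq_bigr do rewrite encE.
have deg' : (mdeg a + mdeg b' <= i)%N.
  apply: leq_trans deg; rewrite leq_add2l !mdegE leq_sum // => j _.
  by rewrite b'E leq_subr.
have ai : (mdeg a < i.+1)%N by lia.
have bi : (mdeg b' < i.+1)%N by lia.
apply/imsetP; exists ((BMultinom ai, BMultinom bi), Ordinal rq).
  rewrite !inE andbT /mweight /= deg' andbT; apply/forallP => j /=.
  rewrite /fgood; case: eqP => [j0|/eqP j0] /=.
    have -> : j = o by apply: val_inj.
    rewrite b'E eqxx mul1n /r {1}(divn_eq (b o) q) addnK dvdn_mull //.
  by rewrite mnmE; case: leqP.
apply: eq_from_tnth => l; rewrite tnth_mktuple /= bE encE.
by apply: val_inj; rewrite /= inordK // ltn_ord.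
Qed.

Lemma card_good_upper i : (q * #|good_set i| <= 'C(D + (i + q), D))%N.
Proof.
rewrite -card_partial_ord_partitions mulnC -[q in leqLHS]card_ord -cardsT -cardsX.
have encP x : x \in finset.setX (good_set i) [set: 'I_q] ->
    (\sum_l enc (bmnm x.1.1) (shift (bmnm x.1.2) x.2) l <= i + q)%N.
  case: x => [[a b] r]; rewrite !inE andbT => /andP[/good0 g w] /=.
  rewrite enc_sum //; move: w; rewrite /mweight /= /shift mdegD mdegMn mdeg1 mul1n.
  by have := ltn_ord r; lia.
have tupE x l : x \in finset.setX (good_set i) [set: 'I_q] ->
    tnth (tup (i + q) x) l = enc (bmnm x.1.1) (shift (bmnm x.1.2) x.2) l :> nat.
  move=> /encP xi; rewrite tnth_mktuple inordK // ltnS; apply: leq_trans xi.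
  by rewrite (bigD1 l) //= leq_addr.
rewrite -(card_in_imset (f := tup (i + q) (i := i))).
  apply/subset_leq_card/fintype.subsetP => _ /imsetP[x xA ->]; rewrite inE tup_sum.
  by under eq_bigr do rewrite (tupE _ _ xA); exact: encP.
move=> x y xA yA exy.
have {}exy l : enc (bmnm x.1.1) (shift (bmnm x.1.2) x.2) l =
    enc (bmnm y.1.1) (shift (bmnm y.1.2) y.2) l.
  by rewrite -!tupE // exy.
case: x y xA yA exy => [[a b] r] [[a' b'] r'].
rewrite !inE !andbT => /andP[g _] /andP[g' _] /= e.
have bb' j : (b j + (o == j) * r = b' j + (o == j) * r')%N.
  by rewrite -!shiftE -(encr (bmnm a)) -(encr (bmnm a')) e.
(* Good pairs have beta_0 divisible by q, so the residue is recovered by reduction modulo q. *)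
have rr' : r = r' :> nat.
  have := congr1 (modn^~ q) (bb' o); rewrite eqxx !mul1n.
  have [/dvdnP[x /= ->] /dvdnP[y /= ->]] := (gooddvd g, gooddvd g').
  by rewrite !modnMDl !modn_small.
have aa' : a = a'.
  apply/val_inj/mnmP => j; case: (leqP j s) => js.
    rewrite (_ : j = widen_ord sn (inord j)); last first.
      by apply: val_inj; rewrite /= inordK.
    have := e (lshift n (inord j)); by rewrite !encl.
  by rewrite (good0 g js) (good0 g' js).
have bb : b = b'.
  apply/val_inj/mnmP => j; have := bb' j; rewrite rr'; exact: addIn.
by rewrite aa' bb (val_inj rr').
Qed.

(** D! C(D+i, D) is the falling factorial of D+i of length D, which lies between i^D and (D+i)^D. *)
Lemma card_good_bounds i :
  (i ^ D <= D`! * (q * #|good_set i|) <= (i + (D + q)) ^ D)%N.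
Proof.
apply/andP; split.
  apply: leq_trans (leq_exp_ffact i D) _.
  by rewrite -bin_ffact mulnC leq_mul2l card_good_lower orbT.
apply: (@leq_trans ((D + (i + q)) ^_ D)).
  by rewrite -bin_ffact mulnC leq_mul2r card_good_upper orbT.
by rewrite addnCA; exact: ffact_leq_exp.
Qed.

End Counting.

(** * The Hilbert function of the canonical generator *)

Section MksDimension.
Context {K : fieldType} {p : nat} (hp : p \in [pchar K]) {n : nat} (k s : nat).
Local Notation fg := (fun i : 'I_n => fgens (p := p) k s i).

(** The basis consists of the good monomials of weight at most i applied to [e]: independent by
    [mgood_dual], spanning by [mgood_red]. *)
Lemma presents_has_dim (M : lmodType (DP K n)) (e : M) i :
  presents e (gensn fg) ->
  has_dim (prodspan (canonical_filtration i) [set e]%classic : set (restr M))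
    #|good_set p k s n i|.
Proof.
move=> [gen ker]; set A := good_set p k s n i.
pose y (j : 'I_#|A|) := (bmnm (enum_val j).1, bmnm (enum_val j).2).
have y_inj : injective y.
  move=> j l; rewrite /y => -[/val_inj e1 /val_inj e2]; apply: enum_val_inj.
  by rewrite [LHS]surjective_pairing e1 e2 -surjective_pairing.
have yP j : mgood (p := p) k s (y j) /\ (mweight (y j) <= i)%N.
  by have := enum_valP j; rewrite inE => /andP[].
exists (fun j => mopn (y j) *: e); split=> [c c0 j|].
  have [f [fJ fE]] := mgood_dual hp (yP j).1.
  have : f (\sum_l c l *: mopn (y l)) = 0.
    apply/fJ/ker; rewrite scaler_suml -[RHS]c0; apply: eq_bigr => l _.
    by rewrite restr_scaleE scalerA mulr_algl.
  rewrite linear_sum (bigD1 j) //= linearZ /= fE ?(yP j).1 // eqxx.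
  rewrite [_ *: _]mulr1 big1 ?addr0 // => l lj.
  by rewrite linearZ /= fE ?(yP l).1 // (inj_eq y_inj) (negPf lj) scaler0.
apply/seteqP; split=> [m|_ [c ->]]; last first.
  apply: subspace_sum; first exact: prodspan_subspace.
  move=> j _; apply/prodspan1; exists (mopn (y j)) => //.
  exact/filtration_mopn/(yP j).2.
move=> /prodspan1[u Fu ->].
have [S0 SD] := @fspan_subspace K (restr M) _ (fun j => mopn (y j) *: e).
move: u Fu; apply: filtration_ind => [|u v Su Sv|c x xi].
- by rewrite scale0r.
- by rewrite scalerDl; have := SD 1 _ _ Su Sv; rewrite scale1r.
have [c' [z [gz zx Jz]]] := mgood_red hp k s x.
have xz : mopn x *: e = c' *: (mopn z *: e : restr M).
  move/ker/eqP: Jz; rewrite scalerBl subr_eq0 => /eqP ->.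
  exact: restr_scalerA.
rewrite restr_scalerA xz scalerA -[_ *: _]addr0.
apply: SD => //.
have zi := leq_trans zx xi.
have z1 : (mdeg z.1 < i.+1)%N by move: zi; rewrite /mweight; lia.
have z2 : (mdeg z.2 < i.+1)%N by move: zi; rewrite /mweight; lia.
have zA : (BMultinom z1, BMultinom z2) \in A.
  by rewrite inE /= -surjective_pairing gz.
exists (fun j => (j == enum_rank_in zA (BMultinom z1, BMultinom z2))%:R).
rewrite (bigD1 (enum_rank_in zA (BMultinom z1, BMultinom z2))) //= eqxx scale1r.
rewrite big1 ?addr0 => [|j /negPf ->]; last by rewrite scale0r.
by rewrite /y enum_rankK_in //= -surjective_pairing.
Qed.

End MksDimension.

(** * Asymptotics *)

Section Asymptotics.
Local Open Scope classical_set_scope.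
Context {R : realType}.
Variables (h : nat -> nat) (D Q b c : nat).
Hypotheses (Q_gt0 : (0 < Q)%N)
  (h_lower : forall i, (i ^ D <= Q * h (i + b))%N)
  (h_upper : forall i, (Q * h i <= (i + c) ^ D)%N).

Lemma shift_pow_cvg (a : R) :
  (fun i : nat => (1 + a * (i%:R)^-1) ^+ D) @ \oo --> (1 : R).
Proof.
have inv0 : (fun i : nat => (i%:R : R)^-1) @ \oo --> (0 : R).
  apply/gtr0_cvgV0; last exact: cvgr_idn.
  by exists 1%N => // i /= i0; rewrite ltr0n.
have : (fun i : nat => 1 + a * (i%:R : R)^-1) @ \oo --> (1 + a * 0 : R).
  by apply: cvgD; [exact: cvg_cst|apply: cvgM => //; exact: cvg_cst].
rewrite mulr0 addr0 => H; rewrite -[X in _ --> X](expr1n R D).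
by apply: (cvg_comp _ (fun x : R => x ^+ D) H); exact: exprn_continuous.
Qed.

(** The shifts by [b] and [c] do not affect the leading term, so Q h(i) is asymptotic to i^D; the
    lower bound is used at i - b. *)
Lemma hilbert_asymptotic (eps : R) : 0 < eps -> \forall i \near \oo,
  (1 - eps) * i%:R ^+ D <= Q%:R * (h i)%:R <= (1 + eps) * i%:R ^+ D.
Proof.
move=> e0; near=> i.
have i0 : (0 < i)%N by near: i; exists 1%N.
have ib : (b <= i)%N by near: i; exact: nbhs_infty_ge.
have iR : (0 : R) < i%:R by rewrite ltr0n.
apply/andP; split.
  have : ((i - b) ^ D <= Q * h i)%N by rewrite -[in leqRHS](subnK ib).
  rewrite -(ler_nat R) natrM natrX; apply: le_trans.
  have -> : (i - b)%:R ^+ D = (1 + - b%:R * (i%:R)^-1) ^+ D * i%:R ^+ D :> R.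
    by rewrite -exprMn mulrDl mul1r mulrAC -mulrA divff ?gt_eqF // mulr1 natrB.
  rewrite ler_wpM2r ?exprn_ge0 ?ler0n //; near: i.
  by apply: (cvgr_ge 1 (shift_pow_cvg (- b%:R))); rewrite ltrBlDr ltrDl.
have := h_upper i; rewrite -(ler_nat R) natrM natrX => /le_trans; apply.
have -> : (i + c)%:R ^+ D = (1 + c%:R * (i%:R)^-1) ^+ D * i%:R ^+ D :> R.
  by rewrite -exprMn mulrDl mul1r mulrAC -mulrA divff ?gt_eqF // mulr1 natrD.
rewrite ler_wpM2r ?exprn_ge0 ?ler0n //; near: i.
by apply: (cvgr_le 1 (shift_pow_cvg c%:R)); rewrite ltrDl.
Unshelve. all: by end_near. Qed.

Lemma powR_unbounded (r A : R) : 0 < r -> \forall i \near \oo, A <= (i%:R : R) `^ r.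
Proof.
move=> r0; near=> i.
have Ai : (Num.max A 0) `^ r^-1 <= i%:R by near: i; exact: nbhs_infty_ger.
apply: (@le_trans _ _ (Num.max A 0)); first by rewrite le_max lexx.
have -> : Num.max A 0 = ((Num.max A 0) `^ r^-1) `^ r.
  by rewrite -powRrM mulVf ?lt0r_neq0 // powRr1 // le_max lexx orbT.
by rewrite ge0_ler_powR ?nnegrE ?powR_ge0 ?ler0n // ltW.
Unshelve. all: by end_near. Qed.

Lemma growth_asymptotic : growth R h = (D%:R%:E)%E.
Proof.
have Q1 : (1 : R) <= Q%:R by rewrite ler1n.
apply/eqP; rewrite eq_le; apply/andP; split.
  apply/lee_addgt0Pr => d d0; apply: ereal_inf_lbound.
  exists (D%:R + d) => //; split; first by rewrite addr_ge0 ?ler0n // ltW.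
  (* Upper bound: h(i) is at most 2 i^D, and i^d eventually absorbs the factor 2, so every exponent
     D + d with d > 0 is admissible. *)
  have H1 := hilbert_asymptotic (ltr01 : (0 : R) < 1).
  have H2 := powR_unbounded 2 d0.
  near=> i; have i0 : (0 < i)%N by near: i; exists 1%N.
  have hi : Q%:R * (h i)%:R <= (1 + 1) * (i%:R : R) ^+ D.
    by near: i; apply: filterS H1 => j /andP[].
  have id : 2 <= (i%:R : R) `^ d by near: i.
  rewrite powRD ?powR_mulrn ?ler0n //; last by rewrite pnatr_eq0 -lt0n i0 implybT.
  apply: (@le_trans _ _ (Q%:R * (h i)%:R)); first by rewrite ler_peMl ?ler0n.
  apply: (le_trans hi); rewrite mulrC ler_wpM2l ?exprn_ge0 ?ler0n //.
apply: le_ereal_inf_tmp => _ [r [r0 hr] <-]; rewrite lee_fin leNgt; apply/negP => rD.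
have rD' : 0 < D%:R - r by rewrite subr_gt0.
(* Lower bound: an admissible r < D would give i^D / 2 <= Q i^r, while eventually i^D >= 3 Q i^r. *)
have H1 := hilbert_asymptotic (eps := 1 / 2) ltac:(by lra).
have H2 := powR_unbounded (3 * Q%:R) rD'.
near \oo => i; have i0 : (0 < i)%N by near: i; exists 1%N.
have iR : (0 : R) < i%:R by rewrite ltr0n.
have hi : (1 - 1 / 2) * (i%:R : R) ^+ D <= Q%:R * (h i)%:R.
  by near: i; apply: filterS H1 => j /andP[].
have hi2 : (h i)%:R <= (i%:R : R) `^ r by near: i.
have iD : 3 * Q%:R <= (i%:R : R) `^ (D%:R - r) by near: i.
have ir : 0 < (i%:R : R) `^ r by rewrite powR_gt0.
have e : i%:R ^+ D = (i%:R : R) `^ (D%:R - r) * i%:R `^ r.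
  by rewrite -powRD ?subrK ?powR_mulrn ?ler0n // (gt_eqF iR) implybT.
have le1 : 3 * Q%:R * (i%:R : R) `^ r <= i%:R ^+ D by rewrite e ler_wpM2r // ltW.
have le2 : Q%:R * (h i)%:R <= Q%:R * (i%:R : R) `^ r by rewrite ler_wpM2l // ler0n.
have : 0 < Q%:R * (i%:R : R) `^ r by rewrite mulr_gt0 // (lt_le_trans ltr01).
lra.
Unshelve. all: by end_near. Qed.

Lemma littleo_asymptotic :
  ((fun i => (h i)%:R) : nat -> R) =
  (fun i => Q%:R^-1 * i%:R ^+ D) +o_\oo (fun i => i%:R ^+ D : R).
Proof.
apply/eqaddoP => eps e0.
have QR : (0 : R) < Q%:R by rewrite ltr0n.
(* The error is eps Q because the estimate is divided by Q afterwards. *)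
have H := hilbert_asymptotic (mulr_gt0 e0 QR).
near=> i.
have l : (1 - eps * Q%:R) * i%:R ^+ D <= Q%:R * (h i)%:R.
  by near: i; apply: filterS H => j /andP[].
have u : Q%:R * (h i)%:R <= (1 + eps * Q%:R) * i%:R ^+ D.
  by near: i; apply: filterS H => j /andP[].
rewrite [`|i%:R ^+ D|]ger0_norm ?exprn_ge0 ?ler0n //.
rewrite -[(_ - _) i]/((h i)%:R - Q%:R^-1 * i%:R ^+ D) ler_distl.
have Q0 : (Q%:R : R) != 0 by rewrite lt0r_neq0.
apply/andP; split; rewrite -(ler_pM2l QR).
  by rewrite mulrBr mulVKf // mulrA [Q%:R * eps]mulrC -[X in X - _]mul1r -mulrBl.
by rewrite mulrDr mulVKf // mulrA [Q%:R * eps]mulrC -[X in X + _]mul1r -mulrDl.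
Unshelve. all: by end_near. Qed.

Lemma not_poly_bounded (m : nat) (P : {poly rat}) : (m < D)%N -> size P = m.+1 ->
  ~ \forall i \near \oo, (h i)%:R <= P.[i%:R].
Proof.
move=> mD sP [N _ HN].
pose C := \sum_(j < m.+1) `|P`_j|.
have C0 : 0 <= C by apply: sumr_ge0.
pose B := Num.bound C.
have hB i : (N <= i)%N -> (0 < i)%N -> (h i <= B * i ^ m)%N.
  move=> Ni i0; rewrite -(ler_nat rat) natrM natrX; apply: le_trans (HN i Ni) _.
  apply: (@le_trans _ _ (C * i%:R ^+ m)); last first.
    by rewrite ler_wpM2r ?exprn_ge0 ?ler0n // ltW // archi_boundP.
  rewrite horner_coef sP mulr_suml; apply: ler_sum => j _.
  apply: (le_trans (ler_norm _)); rewrite normrM ler_wpM2l //.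
  rewrite ger0_norm ?exprn_ge0 ?ler0n // ler_weXn2l ?ler1n // -ltnS ltn_ord //.
(* With i >= b one has (i+b)^m <= (2i)^m, so i^(m+1) <= Q B 2^m i^m, contradicting i > Q B 2^m; the
   summand [N] reaches the range where the polynomial bound holds. *)
pose i := (Q * (B * 2 ^ m) + N + b + 1)%N.
have i0 : (0 < i)%N by rewrite /i addn1.
have : (i ^ m.+1 <= Q * (B * 2 ^ m) * i ^ m)%N.
  apply: (@leq_trans (i ^ D)); first by rewrite leq_pexp2l.
  apply: leq_trans (h_lower i) _; rewrite -mulnA leq_mul2l; apply/orP; right.
  apply: leq_trans (hB _ _ _) _; [by rewrite /i; lia|by lia|].
  rewrite -mulnA leq_mul2l -expnMn; apply/orP; right.
  by case: (m) => // m'; rewrite leq_exp2r // /i; lia.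
by rewrite expnS leq_pmul2r ?expn_gt0 ?i0 // /i; lia.
Qed.

End Asymptotics.

(** * Dimension and multiplicity of M(k, s) *)

Lemma presents_cyclic (A : nzRingType) (N : lmodType A) (e : N) (S : set A) :
  presents e S -> cyclic_module N.
Proof.
move=> [gen _]; exists e; apply/seteqP; split=> // m _.
by have [u ->] := gen m; apply/lspanZ/lspan_gen.
Qed.

(** A cyclic module with finitely many relations is a cokernel onto the free module of rank one,
    here encoded as rows of length one. *)
Lemma presents_finitely_presented (A : nzRingType) (N : lmodType A) (e : N)
    (l : seq A) :
  presents e [set` l]%classic -> finitely_presented N.
Proof.
move=> [gen ker]; pose row1 (a : A) : 'rV[A]_1 := \row__ a.
pose f (x : 'rV[A]_1) := x ord0 ord0 *: e.
have fl : linear f by move=> a x y; rewrite /f !mxE scalerDl scalerA.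
have row1K (x : 'rV[A]_1) : row1 (x ord0 ord0) = x.
  by apply/matrixP => i j; rewrite mxE !ord1.
exists 1%N, [seq row1 a | a <- l], (linear_of fl); split=> [y|x].
  by have [a ->] := gen y; exists (row1 a); rewrite /= /f mxE.
rewrite [_ x]/(x ord0 ord0 *: e) ker; split=> [|xS].
  rewrite -[in X in _ -> X](row1K x); move: (x _ _).
  apply: (lspan_ind (P := fun a : A^o =>
    lspan [set` [seq row1 a | a <- l]]%classic (row1 a))).
  - rewrite (_ : row1 0 = 0); [exact: lspan0|by apply/matrixP => i j; rewrite !mxE].
  - move=> a b; rewrite (_ : row1 (a + b) = row1 a + row1 b); first exact: lspanD.
    by apply/matrixP => i j; rewrite !mxE.
  - move=> a b bl; rewrite (_ : row1 (a *: b) = a *: row1 b); last first.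
      by apply/matrixP => i j; rewrite !mxE.
    by apply/lspanZ/lspan_gen; exact: map_f.
move: x xS; apply: (lspan_ind
  (P := fun x : 'rV[A]_1 => lspan ([set` l]%classic : set A^o) (x ord0 ord0))).
- by rewrite mxE; exact: lspan0.
- by move=> x y; rewrite mxE; exact: lspanD.
- move=> a _ /mapP[b bl ->]; rewrite !mxE.
  by apply: (lspanZ (V := A^o)); exact: lspan_gen.
Qed.

Section Mks.
Context {K : fieldType} {p : nat} (hp : p \in [pchar K]) {n : nat} (k s : nat).
Hypothesis sn : (s < n)%N.
Local Notation D := (s.+1 + n)%N.
Local Notation Q := (D`! * p ^ k)%N.

Let p_gt0 : (0 < p)%N. Proof. by rewrite prime_gt0 ?(pcharf_prime hp). Qed.

Let Q_gt0 : (0 < Q)%N. Proof. by rewrite muln_gt0 fact_gt0 expn_gt0 p_gt0. Qed.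

Lemma gensn_seq (gens : 'I_n -> seq (nat * nat)) :
  gensn (K := K) gens = [set` flatten [seq [seq tensor_op
    (dfwith (T := fun=> DP1 K) (fun=> 1) (i := i) (mop1 g)) | g <- gens i] |
    i <- enum 'I_n]]%classic.
Proof.
apply/seteqP; split=> [u [i [g [gi ->]]]|
  u /= /flattenP[_ /mapP[i _ ->] /mapP[g gi ->]]].
  by apply/flattenP; eexists; [apply: map_f; exact: mem_enum|exact: map_f].
by exists i, g.
Qed.

Variable M : lmodType (DP K n).
Hypothesis MP : is_Mks hp k s M.

Lemma Mks_cyclic : cyclic_module M.
Proof. by have [e eP] := Mks_presents MP; exact: presents_cyclic eP. Qed.

Lemma Mks_finitely_presented : finitely_presented M.
Proof.
have [e eP] := Mks_presents MP; rewrite gensn_seq in eP.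
exact: presents_finitely_presented eP.
Qed.

Lemma Mks_generated : exists M0 : set M, generating_subspace M0.
Proof.
have [e eP] := Mks_presents MP.
(* F_0 e contains e = 1 e and is finite-dimensional by the computed Hilbert function. *)
exists (prodspan (canonical_filtration 0) [set e]%classic); split.
  by eexists; exact: (presents_has_dim hp 0 eP).
apply/seteqP; split=> // m _; have [u ->] := eP.1 m; apply/lspanZ/lspan_gen.
apply/prodspan1; exists 1; last by rewrite scale1r.
rewrite -(mop00 (mpoly_mbasis (K := K) (n := n))).
by apply: (filtration_mopn (x := (0%MM, 0%MM))); rewrite /mweight /= !mdeg0.
Qed.

Lemma Mks_hilbert (M0 : set M) : generating_subspace M0 ->
  exists b c, forall i, (i ^ D <= Q * hilbert M0 (i + b))%N /\
                        (Q * hilbert M0 i <= (i + c) ^ D)%N.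
Proof.
move=> M0gen; have [e eP] := Mks_presents MP.
have [a [b ab]] :=
  hilbert_sandwich eP.1 (fun i => presents_has_dim hp i eP) M0gen.
exists b, (a + (D + p ^ k))%N => i; have [le1 le2] := ab i.
have /andP[lo _] := card_good_bounds k p_gt0 sn i.
have /andP[_ up] := card_good_bounds k p_gt0 sn (i + a).
split.
  by apply: leq_trans lo _; rewrite mulnA leq_mul2l le1 orbT.
by rewrite addnA; apply: leq_trans up; rewrite mulnA leq_mul2l le2 orbT.
Qed.

Lemma Mks_Dim (R : realType) : has_Dim M ((n + 1 + s)%:R%:E : \bar R).
Proof.
split=> [|M0 M0gen]; first exact: Mks_generated.
have [b [c bc]] := Mks_hilbert M0gen.
have -> : (n + 1 + s = D)%N by lia.
exact: (growth_asymptotic Q_gt0 (fun i => (bc i).1) (fun i => (bc i).2)).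
Qed.

Lemma Mks_multiplicity (R : realType) : has_multiplicity M ((p ^ k)%:R^-1 : R).
Proof.
exists (n + 1 + s)%N; split=> [|M0 M0gen]; first exact: Mks_Dim.
have [b [c bc]] := Mks_hilbert M0gen.
have -> : (n + 1 + s = D)%N by lia.
have -> : (p ^ k)%:R^-1 / D`!%:R = Q%:R^-1 :> R by rewrite natrM invfM mulrC.
exact: (littleo_asymptotic Q_gt0 (fun i => (bc i).1) (fun i => (bc i).2)).
Qed.

Lemma Mks_not_holonomic : ~ holonomic M.
Proof.
move=> [_ [M0 [M0gen [P [sP HP]]]]].
have [b [c bc]] := Mks_hilbert M0gen.
have nD : (n < D)%N by lia.
exact: (not_poly_bounded Q_gt0 (fun i => (bc i).1) nD sP HP).
Qed.

End Mks.

Theorem lemma5p6 (R : realType) (K : fieldType) (p : nat)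
    (hp : p \in [pchar K]) (n : nat) (hn : (1 <= n)%N) :
  (forall s k : nat, (s < n)%N ->
     (exists M : lmodType (DP K n), is_Mks hp k s M) /\
     (forall M : lmodType (DP K n), is_Mks hp k s M ->
        [/\ cyclic_module M,
            finitely_presented M,
            has_Dim M ((n + 1 + s)%:R%:E : \bar R) &
            has_multiplicity M ((p ^ k)%:R^-1 : R)])) /\
  (forall (s : nat) (eps : R), (s < n)%N -> 0 < eps ->
     exists M : lmodType (DP K n),
       [/\ finitely_presented M,
           ~ holonomic M,
           has_Dim M ((n + 1 + s)%:R%:E : \bar R) &
           exists e : R, has_multiplicity M e /\ 0 < e < eps]).
Proof.
split=> [s k sn|s eps sn e0].
  split=> [|M MP]; first exact: Mks_exists.
  split; [exact: (Mks_cyclic MP)|exact: (Mks_finitely_presented MP)|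
          exact: (Mks_Dim sn MP R)|exact: (Mks_multiplicity sn MP R)].
(* This gives 1/eps < k < p^k, hence 1/p^k < eps. *)
pose k := Num.bound eps^-1.
have [M MP] := Mks_exists hp (n := n) k s.
exists M; split; [exact: (Mks_finitely_presented MP)|
  exact: (Mks_not_holonomic sn MP)|exact: (Mks_Dim sn MP R)|].
exists ((p ^ k)%:R^-1); split; first exact: (Mks_multiplicity sn MP R).
have pk : (k < p ^ k)%N by rewrite ltn_expl // prime_gt1 // (pcharf_prime hp).
have pk0 : (0 : R) < (p ^ k)%:R by rewrite ltr0n (leq_ltn_trans _ pk).
rewrite invr_gt0 pk0 /= invf_plt ?posrE //.
apply: (@lt_trans _ _ k%:R); last by rewrite ltr_nat.
by rewrite archi_boundP // invr_ge0 ltW.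
Qed.
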